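(* Let $k\ge 1$ and $c\in\mathbb{R}$ be fixed and let $p=\frac{k\log n+c}{n}$. Let $HG(n,p)$ be the random hypergraph induced by the random complex $Y_k(n,p)$. Then with probability tending to $1$ as $n\to\infty$, $HG(n,p)$ consists of one giant component together with isolated hypervertices; the number of isolated hypervertices converges in distribution to a Poisson random variable with mean $e^{-c}/k!$; and hence the probability that $HG(n,p)$ is connected tends to $\exp(-e^{-c}/k!)$ as $n\to\infty$. Consequently $p=n^{-1}k\log n$ is a sharp threshold for connectedness of $HG(n,p)$.
   Context: The random $k$-dimensional complex $Y_k(n,p)$ has vertex set $[n]=\{1,\dots,n\}$, contains every subset of $[n]$ of cardinality at most $k$ (complete $(k-1)$-skeleton), and contains each subset of $[n]$ of cardinality $k+1$ (a $k$-face) independently with probability $p$. The induced hypergraph $HG(n,p)$ has hypervertex set $\binom{[n]}{k}$ (all $(k-1)$-faces) and hyperedge set the set of $k$-faces of $Y_k(n,p)$; two hypervertices $\alpha,\alpha'$ are adjacent when $\alpha\cup\alpha'$ is a $k$-face of $Y_k(n,p)$, and connectedness/components are with respect to this adjacency. A hypervertex (i.e. $(k-1)$-face) is isolated if it is contained in no $k$-face of $Y_k(n,p)$. Sharp threshold means: for any $\omega=\omega(n)\to\infty$, with $p=(k\log n+\omega)/n$ the hypergraph is connected with probability tending to 1, and with $p=(k\log n-\omega)/n$ it is disconnected with probability tending to 1. *)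

(* Defs.v *)
From HB Require Import structures.
From mathcomp Require Import all_boot all_order all_algebra.
From mathcomp Require Import all_classical all_reals all_analysis.
Import numFieldNormedType.Exports.

Set Implicit Arguments.
Unset Strict Implicit.
Unset Printing Implicit Defensive.
Import Order.TTheory GRing.Theory Num.Theory.
Local Open Scope classical_set_scope.
Local Open Scope ring_scope.

(* A family of faces on the vertex set 'I_n, with the discrete sigma-algebra. *)
Definition faces (n : nat) : Type := {set {set 'I_n}}.

HB.instance Definition _ n := Finite.copy (faces n) {set {set 'I_n}}.
HB.instance Definition _ n := isPointed.Build (faces n) finset.set0.
HB.instance Definition _ n := @isMeasurable.Build default_measure_display
  (faces n) discrete_measurable discrete_measurable0
  (@discrete_measurableC (faces n)) (@discrete_measurableU (faces n)).

Section random_complex.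
Context {R : realType} (k n : nat) (p : R).

(* The parameter is truncated to [0, 1], so that the law below is a probability
   measure for every real p. *)
Definition trunc01 : R := Num.max 0 (Num.min p 1).

(* Probability that s is a face: the sets of cardinality at most k are always
   faces, those of cardinality k+1 are faces with probability p, and there are
   no larger faces. *)
Definition face_prob (s : {set 'I_n}) : R :=
  if (#|s| <= k)%N then 1 else if #|s| == k.+1 then trunc01 else 0.

(* The events "s is a face" are independent. *)
Definition complex_pmf (Y : faces n) : R :=
  \prod_(s : {set 'I_n}) bernoulli_pmf (face_prob s) (s \in (Y : {set _})).

(* The law of Y_k(n, p). *)
Definition random_complex (A : set (faces n)) : \bar R :=
  (\sum_(Y \in A) (complex_pmf Y)%:E)%E.

Lemma face_prob01 s : 0 <= face_prob s <= 1.
Proof.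
rewrite /face_prob /trunc01; case: ifP => _; first by rewrite ler01 lexx.
case: ifP => _; last by rewrite ler01 lexx.
by rewrite le_max lexx /= ge_max ler01 ge_min lexx orbT.
Qed.

Lemma complex_pmf_ge0 Y : 0 <= complex_pmf Y.
Proof. by apply: prodr_ge0 => s _; apply: bernoulli_pmf_ge0 (face_prob01 s). Qed.

Lemma complex_pmf_sum : \sum_(Y : faces n) complex_pmf Y = 1.
Proof.
under eq_bigr do rewrite /complex_pmf.
transitivity (\prod_(s : {set 'I_n}) (face_prob s + (1 - face_prob s))).
  by rewrite finset.bigA_distr.
by rewrite big1 // => s _; rewrite addrC subrK.
Qed.

Let random_complex0 : random_complex set0 = 0%E.
Proof. by rewrite /random_complex fsbig_set0. Qed.

Let random_complex_ge0 A : (0 <= random_complex A)%E.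
Proof.
rewrite /random_complex fsbig_finite//= sumEFin lee_fin.
by apply: sumr_ge0 => Y _; exact: complex_pmf_ge0.
Qed.

Let random_complex_sigma_additive : semi_sigma_additive random_complex.
Proof.
move=> F mF tF mUF; rewrite /random_complex.
apply: cvg_toP.
  apply: ereal_nondecreasing_is_cvgn => a b ab.
  by apply: lee_sum_nneg_natr => // i _ _; exact: random_complex_ge0.
transitivity (\sum_(0 <= i <oo) \esum_(j in F i) (complex_pmf j)%:E)%E.
  apply: eq_eseriesr => i _; rewrite esum_fset//= => Y _.
  by rewrite lee_fin complex_pmf_ge0.
rewrite -nneseries_sum_bigcup//=; last first.
  by move=> Y; rewrite lee_fin complex_pmf_ge0.
by rewrite esum_fset//= => Y _; rewrite lee_fin complex_pmf_ge0.
Qed.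

HB.instance Definition _ := isMeasure.Build _ _ _ random_complex
  random_complex0 random_complex_ge0 random_complex_sigma_additive.

Let random_complex_setT : random_complex [set: _] = 1%E.
Proof.
rewrite /random_complex fsbig_finite//= sumEFin -complex_pmf_sum.
congr EFin; apply: perm_big; apply: uniq_perm => [||Y].
- exact: finmap.fset_uniq.
- exact: index_enum_uniq.
- by rewrite mem_index_enum in_fset_set ?in_setT//; exact: finite_finset.
Qed.

HB.instance Definition _ :=
  @Measure_isProbability.Build _ _ R random_complex random_complex_setT.

End random_complex.
Arguments random_complex {R} k n p A.

Section hypergraph.
Context (k n : nat).
Implicit Types (Y : faces n) (a b : {set 'I_n}).

Definition hypervertices : {set {set 'I_n}} :=
  [set a : {set 'I_n} | #|a| == k]%SET.

Definition kface Y (s : {set 'I_n}) : bool :=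
  (#|s| == k.+1) && (s \in (Y : {set _})).

Definition HG_adj Y : rel {set 'I_n} := fun a b =>
  [&& a \in hypervertices, b \in hypervertices & kface Y (a :|: b)].

Definition HG_connected Y : bool :=
  [forall a in hypervertices, forall b in hypervertices,
    connect (HG_adj Y) a b].

Definition HG_component Y a : {set {set 'I_n}} :=
  [set b in hypervertices | connect (HG_adj Y) a b]%SET.

Definition isolated_hypervertex Y a : bool :=
  (a \in hypervertices) && ~~ [exists s, kface Y s && (a \subset s)].

(* "One giant component together with isolated hypervertices": a component is
   giant when it contains asymptotically all hypervertices, which is expressed
   by asking this event to have probability tending to 1 for every eps > 0. *)
Definition giant_and_isolated {R : realType} (eps : R) Y : bool :=
  [exists a in hypervertices,
    ((1 - eps) * #|hypervertices|%:R <= #|HG_component Y a|%:R) &&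
    [forall b in hypervertices, (b \in HG_component Y a) || isolated_hypervertex Y b]].

Definition nb_isolated {R : realType} (Y : faces n) : R :=
  #|[set a | isolated_hypervertex Y a]%SET|%:R.

End hypergraph.
Arguments hypervertices : clear implicits.
Arguments kface k {n} Y s.
Arguments HG_adj k {n} Y a b.
Arguments HG_connected k {n} Y.
Arguments HG_component k {n} Y a.
Arguments isolated_hypervertex k {n} Y a.
Arguments giant_and_isolated k {n R} eps Y.
Arguments nb_isolated k n {R} Y.

HB.instance Definition _ (R : realType) (k n : nat) :=
  isMeasurableFun.Build _ _ (faces n) R (nb_isolated k n)
    (fun _ _ _ => I).

(* The identity of nat, seen as a real random variable. *)
Definition nat_val {R : realType} (j : nat) : R := j%:R.

HB.instance Definition _ (R : realType) :=
  isMeasurableFun.Build _ _ nat R (@nat_val R) (fun _ _ _ => I).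

(* Convergence in distribution, for random variables that may live on
   different probability spaces. *)
Definition cvg_in_distribution {R : realType}
    (d : nat -> measure_display) (T : forall n, measurableType (d n))
    (P : forall n, probability (T n) R) (X : forall n, {RV (P n) >-> R})
    (d' : measure_display) (T' : measurableType d')
    (Q : probability T' R) (Z : {RV Q >-> R}) : Prop :=
  forall x : R, {for x, continuous (cdf Z)} ->
    cdf (X n) x @[n --> \oo] --> cdf Z x.

(* Main.v *)
Require Import Defs.
From mathcomp Require Import all_boot all_order all_algebra all_fingroup.
From mathcomp Require Import all_classical all_reals all_analysis.
From mathcomp Require Import zify lra ring.
From mathcomp Require Import fintype finset.
Import numFieldNormedType.Exports.
Import Order.TTheory GRing.Theory Num.Theory.
Set Implicit Arguments.
Unset Strict Implicit.
Unset Printing Implicit Defensive.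

(* Idea.  Let N = 'C(n, k).  A hypervertex a is isolated iff its component is
   {a}, so everything follows from two facts about p = (k ln n + c) / n.

   (1) With high probability no component has size in [2, N/2].  If the
   component of a is S, then the set D of (k+1)-sets containing both a member of
   S and a k-set outside S is free of faces, while at most #|S| faces suffice to
   connect S.  Thinning the faces off D by a factor 1/4 thus costs at most
   4^#|S|, and thinning them on D gains exp(-3p/4) for each element of D:
     P_p(C(a) = S) <= 4^#|S| exp(-(3/4) p #|D|) P_(p/4)(C(a) = S).
   Summing over the S of size s replaces any enumeration of spanning trees:
   P_p(#|C(a)| = s) <= 4^s exp(-(3/4) p min #|D|).  For bounded s one has
   #|D| >= s(n - k) - s^2, and for s <= N/2 an isoperimetric inequality gives
   #|D| >= s(n - k) / (2k(k + 1)).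

   (2) The binomial moments E 'C(X, r) of the number X of isolated hypervertices
   tend to lambda^r / r!, and the Bonferroni inequalities turn this into
   convergence of P(X = j).

   The threshold statement follows because connectedness is increasing in p. *)

(** * Cofaces of a family of hypervertices *)

Lemma card_hypervertices k n : #|hypervertices k n| = 'C(n, k).
Proof. by rewrite card_draws card_ord. Qed.

Section cofaces.
Context (k n : nat).
Implicit Types (a b T A B : {set 'I_n}) (S : {set {set 'I_n}}).

Definition cofaces S : {set {set 'I_n}} :=
  [set T : {set 'I_n} | (#|T| == k.+1) && [exists a in S, a \subset T]].

(** The edge boundary of S, the set D of the argument: when S is a component, a face here would join
    S to its complement. *)
Definition split_faces S : {set {set 'I_n}} :=
  [set T in cofaces S | [exists b in hypervertices k n :\: S, b \subset T]].

Lemma card_cofaces1 a : #|a| = k -> #|cofaces [set a]| = n - k.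
Proof.
move=> ak.
have -> : cofaces [set a] = (fun v => v |: a) @: (~: a).
  apply/setP => T; rewrite !inE; apply/andP/imsetP.
    move=> [/eqP Tk /existsP[b /andP[/set1P -> aT]]].
    have : #|T :\: a| == 1%N by rewrite cardsDS// Tk ak; lia.
    move/cards1P => [v Tav]; exists v.
      have : v \in T :\: a by rewrite Tav set11.
      by rewrite !inE => /andP[].
    by rewrite -Tav setUC -{1}(setIidPr aT) setID.
  move=> [v]; rewrite inE => va ->; rewrite cardsU1 va ak; split=> //.
  by apply/existsP; exists a; rewrite set11 subsetU1.
rewrite card_in_imset; first by rewrite cardsCs setCK card_ord ak.
move=> u v.
rewrite !inE => ua va uv.
have : u \in v |: a by rewrite -uv setU11.
by rewrite !inE (negbTE ua) orbF => /eqP.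
Qed.

Lemma card_cofaces_le S : S \subset hypervertices k n ->
  #|cofaces S| <= #|S| * (n - k).
Proof.
move=> /subsetP SH.
apply: (@leq_trans (\sum_(a in S) #|cofaces [set a]|)).
  have -> : cofaces S = \bigcup_(a in S) cofaces [set a].
    apply/setP => T; apply/idP/bigcupP.
      rewrite inE => /andP[Tk /existsP[a /andP[aS aT]]].
      exists a => //; rewrite inE Tk; apply/existsP; exists a.
      by rewrite set11.
    move=> [a aS]; rewrite !inE => /andP[-> /existsP[b /andP[/set1P -> aT]]].
    by apply/existsP; exists a; rewrite aS.
  elim/big_rec2: _ => [|a U m _ le_mU]; first by rewrite cards0.
  by rewrite (leq_trans (leq_card_setU _ _))// leq_add2l.
rewrite (eq_bigr (fun=> n - k)) ?sum_nat_const// => a /SH.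
by rewrite inE => /eqP /card_cofaces1.
Qed.

(** One lower bound on their number serves both [split_faces] and [cofaces]. *)
Definition private_cofaces S : {set {set 'I_n}} :=
  [set T : {set 'I_n} | (#|T| == k.+1) & #|[set a in S | a \subset T]| == 1].

(** The left side counts incidences between S and its cofaces. A set T containing j members of S
    contributes j <= [j = 1] + j(j - 1), and j(j - 1) counts the ordered pairs of distinct members
    inside T. The only T that can contain such a pair is its union, so all pairs together contribute
    at most #|S|^2. *)
Lemma card_private_cofaces S : S \subset hypervertices k n ->
  #|S| * (n - k) <= #|private_cofaces S| + #|S| ^ 2.
Proof.
move=> /subsetP SH.
pose j T := #|[set a in S | a \subset T]|.
have jE T : j T = \sum_(a in S) (a \subset T).
  by rewrite /j -sum1_card big_mkcond [RHS]big_mkcond; apply: eq_bigr => a _;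
    rewrite inE; case: (a \in S) => //=; case: (a \subset T).
have -> : #|S| * (n - k) = \sum_(T : {set 'I_n} | #|T| == k.+1) j T.
  under eq_bigr do rewrite jE.
  rewrite exchange_big/= -sum_nat_const; apply: eq_bigr => a /SH.
  rewrite inE => /eqP /card_cofaces1 <-.
  rewrite -sum1_card big_mkcond [RHS]big_mkcond; apply: eq_bigr => T _.
  rewrite inE; case: eqP => //= _.
  have -> : [exists a0 in [set a], a0 \subset T] = (a \subset T).
    apply/existsP/idP => [[b /andP[/set1P ->]]//|aT].
    by exists a; rewrite set11.
  by case: (a \subset T).
have jjE T : j T * (j T).-1 =
    \sum_(a in S) \sum_(b in S :\ a) ((a \subset T) && (b \subset T)).
  transitivity (\sum_(a in [set a in S | a \subset T]) (j T).-1).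
    by rewrite sum_nat_const.
  rewrite big_mkcond [RHS]big_mkcond; apply: eq_bigr => a _; rewrite inE.
  case: ifP => [/andP[aS aT]|]; last first.
    by case: (a \in S) => //= ->; rewrite big1.
  rewrite aS aT /= /j (cardsD1 a) inE aS aT /= -sum1_card.
  rewrite big_mkcond [RHS]big_mkcond; apply: eq_bigr => b _; rewrite !inE.
  by case: (b == a); case: (b \in S) => //=; case: (b \subset T).
apply: (@leq_trans (\sum_(T : {set 'I_n} | #|T| == k.+1)
   ((j T == 1) + j T * (j T).-1))).
  by apply: leq_sum => T _; case: (j T) => [|[|i]] //=; nia.
rewrite big_split/=; apply: leq_add.
  rewrite -sum1_card big_mkcond [leqRHS]big_mkcond; apply: leq_sum => T _.
  by rewrite inE /j; case: eqP => //= _; case: ifP.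
under eq_bigr do rewrite jjE.
rewrite exchange_big/= expnS expn1 -sum_nat_const; apply: leq_sum => a aS.
rewrite exchange_big/=.
apply: (@leq_trans (\sum_(b in S :\ a) 1)); last first.
  by rewrite sum1_card subset_leq_card// subsetDl.
apply: leq_sum => b; rewrite !inE => /andP[ba bS].
move: (SH _ aS) (SH _ bS); rewrite !inE => /eqP ak /eqP bk.
have kab : k < #|a :|: b|.
  rewrite -ak proper_card// properE subsetUl/=; apply: contra ba => abs.
  rewrite eqEcard ak bk leqnn andbT.
  exact: subset_trans (subsetUr _ _) abs.
rewrite -[leqRHS](card1 (a :|: b)) -sum1_card big_mkcond [leqRHS]big_mkcond.
apply: leq_sum => T _; rewrite inE; case: eqP => [Tk|]; last by case: ifP.
case: andP => [[aT bT]|]; last by case: ifP.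
have sub : a :|: b \subset T by rewrite subUset aT.
by rewrite (_ : T == _)// eq_sym eqEcard sub Tk.
Qed.

Lemma private_cofaces_sub S : private_cofaces S \subset cofaces S.
Proof.
apply/subsetP => T; rewrite !inE => /andP[->] /cards1P[a Ea].
have : a \in [set a in S | a \subset T] by rewrite Ea set11.
by rewrite inE => aST; apply/existsP; exists a.
Qed.

(** If a is the only member of S inside T, remove from T a vertex v of a: the k-set T :\ v differs
    from a, hence lies outside S. Positivity of k provides v. *)
Lemma private_cofaces_split S : 0 < k -> S \subset hypervertices k n ->
  private_cofaces S \subset split_faces S.
Proof.
move=> k0 /subsetP SH; apply/subsetP => T TS.
rewrite inE (subsetP (private_cofaces_sub S))//=.
move: TS; rewrite !inE => /andP[/eqP Tk] /cards1P[a Ea].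
have : a \in [set a in S | a \subset T] by rewrite Ea set11.
rewrite inE => /andP[aS aT].
have [v va] : exists v, v \in a.
  apply/set0Pn; rewrite -card_gt0.
  by move: (SH _ aS); rewrite inE => /eqP ->.
have vT : v \in T by exact: (subsetP aT).
apply/existsP; exists (T :\ v); rewrite !inE subsetDl andbT.
have -> : #|T :\ v| == k by move: Tk; rewrite (cardsD1 v) vT add1n => -[->].
rewrite andbT; apply/negP => TvS.
have : T :\ v \in [set a in S | a \subset T] by rewrite inE TvS subsetDl.
rewrite Ea inE => /eqP Tva; move: va; rewrite -Tva.
by rewrite !inE eqxx.
Qed.

Lemma card_split_faces_small S : 0 < k -> S \subset hypervertices k n ->
  #|S| * (n - k) <= #|split_faces S| + #|S| ^ 2.
Proof.
move=> k0 SH; apply: leq_trans (card_private_cofaces SH) _.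
by rewrite leq_add2r subset_leq_card// private_cofaces_split.
Qed.

End cofaces.

(** * Isoperimetry in the Johnson graph *)

Section isoperimetry.
Context (k n : nat).
Implicit Types (A B T : {set 'I_n}) (S F : {set {set 'I_n}}).

(** A uniform random permutation carries A to a uniform random set of cardinality #|A|; counting
    permutations replaces this probability. *)
Definition perms_into A F : {set 'S_n} := [set g : 'S_n | g @: A \in F].

Lemma card_permim (g : 'S_n) A : #|g @: A| = #|A|.
Proof. by rewrite card_imset//; exact: perm_inj. Qed.

(** Induction on #|A :\: C|: transposing an element of A :\: C with one of C :\: A brings C closer
    to A. *)
Lemma perm_trans_set A B : #|A| = #|B| -> exists g : 'S_n, g @: A = B.
Proof.
move=> AB.
suff H m : forall C, #|A :\: C| = m -> #|C| = #|A| -> exists g : 'S_n, g @: A = C.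
  exact: (H _ B erefl (esym AB)).
elim: m => [|m IH] C.
  move/eqP; rewrite cards_eq0 setD_eq0 => AC CA; exists 1%g.
  have -> : A = C by apply/eqP; rewrite eqEcard AC CA leqnn.
  have E : (fun x => (1%g : 'S_n) x) =1 id by move=> x; rewrite perm1.
  by rewrite (eq_imset _ E) imset_id.
move=> ACm CA.
have [x xAC] : exists x, x \in A :\: C by apply/set0Pn; rewrite -card_gt0 ACm.
have [y yCA] : exists y, y \in C :\: A.
  apply/set0Pn; rewrite -card_gt0 cardsD CA.
  by move: ACm; rewrite cardsD setIC; lia.
move: xAC yCA; rewrite !inE => /andP[xC xA] /andP[yA yC].
have xy : x != y by apply: contra xC => /eqP ->.
pose C' := tperm x y @: C.
have C'E z : (z \in C') = (tperm x y z \in C).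
  by rewrite -{1}(tpermK x y z) mem_imset//; exact: perm_inj.
have [||g gC'] := IH C'.
- have : A :\: C = x |: (A :\: C').
    apply/setP => z; rewrite !inE C'E.
    case: tpermP => [->|->|/eqP zx /eqP zy].
    + by rewrite eqxx xC xA.
    + by rewrite yC (negbTE yA) !andbF eq_sym (negbTE xy).
    + by rewrite (negbTE zx).
  move=> E; move: ACm; rewrite E cardsU1 !inE C'E tpermL yC xA /=; lia.
- by rewrite /C' card_permim.
exists (g * tperm x y)%g.
have E : (g * tperm x y)%g =1 tperm x y \o g by move=> z; rewrite permM.
rewrite (eq_imset _ E) imset_comp gC' /C' -imset_comp.
rewrite (@eq_imset _ _ (tperm x y \o tperm x y) id) ?imset_id// => z.
by rewrite /= tpermK.
Qed.

Lemma card_perms_into_eq A B F : #|A| = #|B| ->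
  #|perms_into A F| = #|perms_into B F|.
Proof.
move=> /perm_trans_set[g <-].
rewrite -[RHS](card_imset _ (@mulgI _ g)); congr #|pred_of_set _|.
apply/setP => h; apply/idP/imsetP => [|[h' + ->]].
  rewrite inE => hA; exists (g^-1 * h)%g; last by rewrite mulKVg.
  rewrite inE -imset_comp; congr (_ \in F): hA.
  by apply: eq_imset => x /=; rewrite permM permK.
rewrite !inE -imset_comp => h'A; congr (_ \in F): h'A.
by apply: eq_imset => x /=; rewrite permM.
Qed.

(** Count the pairs (B, g) with #|B| = #|A| and g @: B in F. For fixed B the count does not depend
    on B, by transitivity; for fixed g it is #|F|, since g permutes the sets of that cardinality. *)
Lemma card_perms_into A F : {in F, forall B, #|B| = #|A|} ->
  'C(n, #|A|) * #|perms_into A F| = n`! * #|F|.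
Proof.
move=> FA; rewrite -[n in 'C(n, _)](card_ord n) -card_draws -sum_nat_const.
rewrite (eq_bigr (fun B : {set 'I_n} => \sum_(g : 'S_n) (g @: B \in F))); last first.
  move=> B; rewrite inE => /eqP BA; rewrite -(card_perms_into_eq _ BA).
  rewrite -sum1_card big_mkcond; apply: eq_bigr => g _; rewrite inE.
  by case: (_ \in F).
rewrite exchange_big/= (eq_bigr (fun=> #|F|)); last first.
  move=> g _.
  rewrite -sum1_card [RHS](reindex_inj (imset_inj (@perm_inj _ g))) /=.
  rewrite big_mkcond [RHS]big_mkcond; apply: eq_bigr => B _; rewrite inE.
  case: (boolP (g @: B \in F)) => [/FA|_]; last by case: ifP.
  by rewrite card_permim => ->; rewrite eqxx.
by rewrite sum_nat_const card_Sn.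
Qed.

(** Induction on #|A :\: B|. Exchange x in A :\: B for y in B :\: A to obtain A'. If g sends A into
    S and B outside, then either g @: A' is in S and the induction applies to A', or g @: (y |: A)
    contains g @: A in S and g @: A' outside S, so it is a split face. All (k+1)-sets give the same
    count as T. *)
Lemma perms_separating A B S T : S \subset hypervertices k n ->
    #|A| = k -> #|B| = k -> #|T| = k.+1 ->
  #|[set g : 'S_n | (g @: A \in S) && (g @: B \notin S)]| <=
    #|A :\: B| * #|perms_into T (split_faces k S)|.
Proof.
move=> SH + Bk Tk; move Em: #|A :\: B| => m; elim: m A Em => [A /eqP|m IH A ABm Ak].
  rewrite cards_eq0 setD_eq0 => AB Ak.
  have -> : A = B by apply/eqP; rewrite eqEcard AB Ak Bk leqnn.
  by rewrite mul0n leqn0 cards_eq0; apply/eqP/setP => g; rewrite !inE andbN.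
have [x xAB] : exists x, x \in A :\: B by apply/set0Pn; rewrite -card_gt0 ABm.
have [y yBA] : exists y, y \in B :\: A.
  apply/set0Pn; rewrite -card_gt0 cardsD Bk.
  by move: ABm; rewrite cardsD setIC Ak; lia.
move: xAB yBA; rewrite !inE => /andP[xB xA] /andP[yA yB].
pose A' := y |: A :\ x.
have Axk : (#|A :\ x|).+1 = k by move: Ak; rewrite (cardsD1 x) xA.
have A'k : #|A'| = k by rewrite cardsU1 !inE (negbTE yA) andbF.
have A'm : #|A' :\: B| = m.
  have -> : A' :\: B = (A :\: B) :\ x.
    apply/setP => z; rewrite !inE; case: (eqVneq z y) => [->|_] /=.
      by rewrite yB andbF.
    by case: (z == x) => //=; rewrite andbF.
  by move: ABm; rewrite (cardsD1 x) !inE xB xA /=; lia.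
have Tk' : #|y |: A| = k.+1 by rewrite cardsU1 yA Ak.
rewrite mulSn (@card_perms_into_eq T (y |: A)) ?Tk ?Tk'//.
have := IH A' A'm A'k; rewrite (@card_perms_into_eq T (y |: A)) ?Tk ?Tk'// => IH'.
apply: leq_trans (leq_add (leqnn _) IH'); apply: leq_trans (leq_card_setU _ _).
apply: subset_leq_card; apply/subsetP => g; rewrite !inE => /andP[gA gB].
rewrite gB andbT orbC; case: (boolP (g @: A' \in S)) => //= gA'.
rewrite card_permim Tk' eqxx /=; apply/andP; split.
  by apply/existsP; exists (g @: A); rewrite gA imsetS// subsetU1.
apply/existsP; exists (g @: A'); rewrite !inE gA' card_permim A'k eqxx /=.
by rewrite imsetS// setUS// subsetDl.
Qed.

(* Count the permutations that send one given k-set into S and another outside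
   S, along a path between the two in the Johnson graph. *)
Lemma card_split_faces_isoperimetric S : k < n -> S \subset hypervertices k n ->
  (n - k) * #|S| * ('C(n, k) - #|S|) <= 'C(n, k) * k * k.+1 * #|split_faces k S|.
Proof.
move=> kn SH.
have [A /= Ak] : exists A : {set 'I_n}, #|A| = k.
  have : 0 < #|hypervertices k n| by rewrite card_hypervertices bin_gt0 ltnW.
  by move=> /card_gt0P[A]; rewrite inE => /eqP; exists A.
have [T /= Tk] : exists T : {set 'I_n}, #|T| = k.+1.
  have : 0 < #|hypervertices k.+1 n| by rewrite card_hypervertices bin_gt0.
  by move=> /card_gt0P[T]; rewrite inE => /eqP; exists T.
have EA : 'C(n, k) * #|perms_into A S| = n`! * #|S|.
  by rewrite -{1}Ak card_perms_into// => B /(subsetP SH); rewrite inE Ak => /eqP.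
have ET : 'C(n, k.+1) * #|perms_into T (split_faces k S)| =
    n`! * #|split_faces k S|.
  rewrite -{1}Tk card_perms_into// => B.
  by rewrite !inE Tk => /andP[/andP[/eqP]].
(* Sum the separation bound over all k-sets B, using #|A :\: B| <= k. A fixed g with g @: A in S
   sends exactly 'C(n, k) - #|S| of the sets B outside S. *)
have sep : #|perms_into A S| * ('C(n, k) - #|S|) <=
    'C(n, k) * (k * #|perms_into T (split_faces k S)|).
  rewrite -card_hypervertices -[X in _ <= X]sum_nat_const.
  apply: (@leq_trans (\sum_(B in hypervertices k n)
      #|[set g : 'S_n | (g @: A \in S) && (g @: B \notin S)]|)); last first.
    apply: leq_sum => B; rewrite inE => /eqP Bk.
    apply: leq_trans (perms_separating SH Ak Bk Tk) _.
    by rewrite leq_mul2r -[X in _ <= X]Ak subset_leq_card ?orbT// subsetDl.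
  rewrite -sum_nat_const.
  under [X in _ <= X]eq_bigr do rewrite -sum1_card big_mkcond.
  rewrite exchange_big/= big_mkcond; apply: leq_sum => g _; rewrite inE.
  case: ifPn => gA; last by [].
  rewrite -(cardsDS SH) -sum1_card (reindex_inj (imset_inj (@perm_inj _ g))).
  rewrite big_mkcond [X in _ <= X]big_mkcond /=; apply: leq_sum => B _.
  by rewrite !inE gA card_permim; case: (_ \in S); case: (_ == k).
have N0 : 0 < 'C(n, k) by rewrite bin_gt0 ltnW.
have := mul_bin_left n k; have := fact_gt0 n.
move: sep EA ET; set a := #|perms_into A S|; set b := #|perms_into T _|.
set N := 'C(n, k); set N1 := 'C(n, k.+1).
set s := #|S|; set d := #|split_faces k S|; set f := n`!.
set u := N - s; set v := n - k.
(* Multiplying by n! turns the two cardinalities into permutation counts, and (k + 1) 'C(n, k + 1) =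
   (n - k) 'C(n, k) exposes the common factor v * N. *)
move=> sep EA ET f0 EN; rewrite -(leq_pmul2l f0).
have -> : f * (v * s * u) = v * N * (a * u).
  by transitivity (v * u * (f * s)); [ring | rewrite -EA; ring].
have -> : f * (N * k * k.+1 * d) = v * N * (N * (k * b)).
  by transitivity (N * k * k.+1 * (f * d)); [ring | rewrite -ET -EN; ring].
by rewrite leq_mul2l sep orbT.
Qed.

End isoperimetry.

(** * Components of the induced hypergraph *)

Section components.
Context (k n : nat).
Implicit Types (Y : faces n) (a b c T : {set 'I_n}) (t S : {set {set 'I_n}}).

Lemma HG_adj_sym Y : symmetric (HG_adj k Y).
Proof. by move=> a b; rewrite /HG_adj setUC andbCA. Qed.

Lemma connect_HG_sym Y : connect_sym (HG_adj k Y).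
Proof. exact/sym_connect_sym/HG_adj_sym. Qed.

Lemma HG_component_self Y a :
  a \in hypervertices k n -> a \in HG_component k Y a.
Proof. by move=> aH; rewrite inE aH connect0. Qed.

Lemma HG_component_sub Y a : HG_component k Y a \subset hypervertices k n.
Proof. by apply/subsetP => b; rewrite inE => /andP[]. Qed.

Lemma HG_component_eq Y a b : b \in HG_component k Y a ->
  HG_component k Y b = HG_component k Y a.
Proof.
rewrite inE => /andP[_ ab]; apply/setP => c; rewrite !inE.
by rewrite (same_connect (connect_HG_sym Y) ab).
Qed.

Lemma HG_component_meet Y a b c : c \in HG_component k Y a ->
  c \in HG_component k Y b -> HG_component k Y a = HG_component k Y b.
Proof. by move=> /HG_component_eq <- /HG_component_eq <-. Qed.

Lemma HG_component_closed Y a b c : b \in HG_component k Y a ->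
  HG_adj k Y b c -> c \in HG_component k Y a.
Proof.
rewrite !inE => /andP[bH ab] bc; move: (bc) => /and3P[_ cH _].
by rewrite inE in cH; rewrite cH; exact: connect_trans ab (connect1 bc).
Qed.

Lemma cofaces_pair T b c : #|T| = k.+1 -> #|b| = k -> #|c| = k -> b != c ->
  b \subset T -> c \subset T -> b :|: c = T.
Proof.
move=> Tk bk ck bc bT cT; apply/eqP; rewrite eqEcard subUset bT cT /= Tk -bk.
rewrite proper_card// properE subsetUl/=; apply: contra bc => bcb.
rewrite eq_sym eqEcard bk ck leqnn andbT.
exact: subset_trans (subsetUr _ _) bcb.
Qed.

Lemma kface_adj Y T b c : kface k Y T -> #|b| = k -> #|c| = k -> b != c ->
  b \subset T -> c \subset T -> HG_adj k Y b c.
Proof.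
move=> YT bk ck bc bT cT; rewrite /HG_adj !inE bk ck eqxx /=.
by rewrite (@cofaces_pair T)//; move: YT => /andP[/eqP].
Qed.

(** As a face, T would make a member of the component adjacent to a hypervertex outside it. *)
Lemma HG_component_split Y a T : T \in split_faces k (HG_component k Y a) ->
  T \notin (Y : {set _}).
Proof.
rewrite !inE => /andP[/andP[/eqP Tk /existsP[b /andP[bC bT]]]].
move=> /existsP[c /andP[]]; rewrite in_setD => /andP[cC cH] cT.
apply/negP => TY; have /negP := cC; apply.
have bH := subsetP (HG_component_sub Y a) _ bC.
rewrite !inE in bH cH; apply: (HG_component_closed bC).
apply: (@kface_adj _ T) => //; [|exact/eqP|exact/eqP|].
  by rewrite /kface Tk eqxx.
by apply: contra cC => /eqP <-.
Qed.

Lemma HG_adjS Y Y' a b : (Y : {set _}) \subset (Y' : {set _}) ->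
  HG_adj k Y a b -> HG_adj k Y' a b.
Proof.
by move=> /subsetP YY'; rewrite /HG_adj /kface => /and3P[-> -> /andP[-> /YY' ->]].
Qed.

Lemma HG_componentS Y Y' a : (Y : {set _}) \subset (Y' : {set _}) ->
  HG_component k Y a \subset HG_component k Y' a.
Proof.
move=> YY'; apply/subsetP => b; rewrite !inE => /andP[-> /=].
by apply: connect_sub => c d /(HG_adjS YY'); exact: connect1.
Qed.

Lemma connect_exit (U : finType) (e : rel U) (x y : U) (C : {set U}) :
  x \in C -> y \notin C -> connect e x y ->
  exists u v, [/\ u \in C, v \notin C & e u v /\ connect e x v].
Proof.
move=> xC yC /connectP[p]; elim/last_ind: p y yC => [y yC _ yx|p z IH y yC].
  by rewrite yx xC in yC.
rewrite rcons_path last_rcons => /andP[xp ez] yz.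
case: (boolP (last x p \in C)) => uC; last exact: (IH _ uC xp erefl).
rewrite yz in yC; exists (last x p), z; split=> //; split=> //.
by apply: connect_trans (connect1 ez); apply/connectP; exists p.
Qed.

(** Grow t one face at a time, keeping at most m faces that connect a to more than m hypervertices,
    itself included. While the component is not exhausted, some adjacency of Y leaves the part
    already reached, and adding its face reaches a new hypervertex. *)
Lemma HG_component_spanning Y a : a \in hypervertices k n ->
  exists t : faces n, [/\ (t : {set _}) \subset (Y : {set _}),
    #|(t : {set _})| < #|HG_component k Y a| &
    HG_component k Y a \subset HG_component k t a].
Proof.
move=> aH; have aC := HG_component_self Y aH.
have grow m : m < #|HG_component k Y a| -> exists t : faces n,
    [/\ (t : {set _}) \subset (Y : {set _}), #|(t : {set _})| <= m &
     m < #|HG_component k t a|].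
  elim: m => [_|m IH mC].
    exists (finset.set0 : {set _}); rewrite sub0set cards0; split=> //.
    by rewrite card_gt0; apply/set0Pn; exists a; exact: HG_component_self.
  have [t [tY tm mt]] := IH (ltnW mC).
  have tC := HG_componentS a tY.
  have [mt'|/negP] := boolP (m.+1 < #|HG_component k t a|).
    by exists t; split=> //; exact: leq_trans tm _.
  move/negP; rewrite -leqNgt => Ct.
  have [y yY yt] : exists2 y, y \in HG_component k Y a & y \notin HG_component k t a.
    apply/subsetPn; apply/negP => /subset_leq_card; lia.
  have axy : connect (HG_adj k Y) a y by move: yY; rewrite inE => /andP[].
  have [u [v [ut vt [uv av]]]] := connect_exit (HG_component_self t aH) yt axy.
  have [uH vH /andP[uvk uvY]] := and3P uv.
  exists ((u :|: v) |: (t : {set _}) : {set _}); split.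
  - by rewrite subUset sub1set uvY.
  - by rewrite cardsU1 -(add1n m) leq_add// leq_b1.
  - apply: leq_trans (_ : #|v |: HG_component k t a| <= _).
      by rewrite cardsU1 vt add1n ltnS.
    have tt' := HG_componentS a (subsetUr [set u :|: v] (t : {set _}) :
      (t : {set _}) \subset (((u :|: v) |: (t : {set _}) : {set _}) : faces n)).
    apply: subset_leq_card; rewrite subUset tt' andbT sub1set.
    apply: (HG_component_closed (subsetP tt' _ ut)).
    by rewrite /HG_adj uH vH /kface uvk setU11.
have C0 : 0 < #|HG_component k Y a| by rewrite card_gt0; apply/set0Pn; exists a.
have [|t [tY tm mt]] := grow #|HG_component k Y a|.-1; first by rewrite prednK.
exists t; split=> //; first by rewrite -(prednK C0) ltnS.
suff /eqP -> : HG_component k t a == HG_component k Y a by [].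
by rewrite eqEcard HG_componentS//= -(prednK C0).
Qed.

(** This is why a component survives any thinning that keeps a spanning t. *)
Lemma HG_component_between Y (t V : faces n) a :
  (t : {set _}) \subset (V : {set _}) -> (V : {set _}) \subset (Y : {set _}) ->
  HG_component k Y a \subset HG_component k t a ->
  HG_component k V a = HG_component k Y a.
Proof.
move=> tV VY Yt; apply/eqP; rewrite eqEsubset HG_componentS//=.
exact: subset_trans Yt (HG_componentS a tV).
Qed.

(** A face T containing a also contains the k-set T :\ v for v in a, which is a neighbour of a;
    conversely any neighbour of a gives a face containing a. *)
Lemma isolated_component Y a : 0 < k -> a \in hypervertices k n ->
  isolated_hypervertex k Y a = (#|HG_component k Y a| <= 1).
Proof.
move=> k0 aH; rewrite /isolated_hypervertex aH /=.
have aC := HG_component_self Y aH.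
apply/negP/idP => [iso|C1 /existsP[T /andP[YT aT]]].
  rewrite leqNgt; apply/negP => /card_gt1P[b [c [bC cC bc]]].
  have [y yC ya] : exists2 y, y \in HG_component k Y a & y \notin [set a].
    have [ba|ba] := eqVneq b a; last by exists b => //; rewrite inE.
    by exists c => //; rewrite inE -ba eq_sym.
  have ay : connect (HG_adj k Y) a y by move: yC; rewrite inE => /andP[].
  have [u [v [/set1P -> _ [uv _]]]] := connect_exit (set11 a) ya ay.
  apply: iso; apply/existsP; exists (a :|: v).
  by move: uv => /and3P[_ _ ->]; rewrite subsetUl.
have /andP[/eqP Tk _] := YT.
have ak : #|a| = k by move: aH; rewrite inE => /eqP.
have [b [bk bT ba]] : exists b, [/\ #|b| = k, b \subset T & a != b].
  have [v va] : exists v, v \in a by apply/set0Pn; rewrite -card_gt0 ak.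
  have vT : v \in T by exact: (subsetP aT).
  exists (T :\ v); split; last 2 first.
  - exact: subsetDl.
  - by apply/eqP => aTv; move: va; rewrite aTv !inE eqxx.
  - by move: Tk; rewrite (cardsD1 v) vT add1n => -[].
have := HG_component_closed aC (kface_adj YT ak bk ba aT bT) => bC.
move: C1; rewrite leqNgt => /negP; apply; apply/card_gt1P.
by exists a, b.
Qed.

(** Joint isolation becomes avoidance of a fixed family of (k+1)-sets, whose probability is a plain
    product. *)
Lemma cofaces_isolated Y S : S \subset hypervertices k n ->
  (S \subset [set a | isolated_hypervertex k Y a]) =
  [disjoint cofaces k S & (Y : {set _})].
Proof.
move=> /subsetP SH; apply/idP/idP.
  move=> /subsetP iso; rewrite disjoint_subset; apply/subsetP => T.
  rewrite !inE => /andP[Tk /existsP[a /andP[/iso + aT]]].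
  rewrite !inE => /andP[_]; apply: contra => TY.
  by apply/existsP; exists T; rewrite /kface Tk TY.
move=> dis; apply/subsetP => a aS; rewrite inE /isolated_hypervertex SH//=.
apply/negP => /existsP[T /andP[/andP[Tk TY] aT]].
have TC : T \in cofaces k S by rewrite inE Tk; apply/existsP; exists a; rewrite aS.
by move: (disjointFr dis TC); rewrite TY.
Qed.

End components.

(** * Consequences of the absence of midsize components *)

Definition midsize_component k n (Y : faces n) : bool :=
  [exists a, (a \in hypervertices k n) &&
    (1 < #|HG_component k Y a| <= 'C(n, k)./2)].

Section large_components.
Context (k n : nat).
Hypotheses (k_gt0 : 0 < k) (k_ltn : k < n).
Implicit Types (Y : faces n) (a b : {set 'I_n}).

Lemma bin_gt1 : 1 < 'C(n, k).
Proof.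
case: n k k_gt0 k_ltn => [|m] [|j] // _ jm; rewrite binS.
have : 0 < 'C(m, j.+1) by rewrite bin_gt0.
have : 0 < 'C(m, j) by rewrite bin_gt0; exact: ltnW.
by lia.
Qed.

Lemma connected_no_isolated Y : HG_connected k Y ->
  #|[set a | isolated_hypervertex k Y a]| = 0.
Proof.
move=> /forall_inP conn; apply/eqP; rewrite cards_eq0; apply/eqP/setP => a.
rewrite in_set0 inE; apply/negP => iso.
have aH : a \in hypervertices k n by move: iso => /andP[].
move: iso; rewrite isolated_component//.
have -> : HG_component k Y a = hypervertices k n.
  apply/setP => b; rewrite inE; case: (boolP (b \in _)) => //= bH.
  exact: (forall_inP (conn a aH)).
by rewrite card_hypervertices leqNgt bin_gt1.
Qed.

(** Both components have more than half of the hypervertices, so they meet. *)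
Lemma big_components_eq Y a b : ~~ midsize_component k Y ->
    a \in hypervertices k n -> b \in hypervertices k n ->
    ~~ isolated_hypervertex k Y a -> ~~ isolated_hypervertex k Y b ->
  HG_component k Y a = HG_component k Y b.
Proof.
move=> mid aH bH; rewrite !isolated_component// -!ltnNge => a1 b1.
have big c : c \in hypervertices k n -> 1 < #|HG_component k Y c| ->
    'C(n, k) < 2 * #|HG_component k Y c|.
  move=> cH c1; rewrite ltnNge; apply: contra mid => cN.
  apply/existsP; exists c; rewrite cH c1 /=.
  by rewrite geq_half_double -mul2n.
have [c /setIP[ca cb]] : exists c, c \in HG_component k Y a :&: HG_component k Y b.
  apply/set0Pn; rewrite -card_gt0.
  have := cardsUI (HG_component k Y a) (HG_component k Y b).
  have : #|HG_component k Y a :|: HG_component k Y b| <= 'C(n, k).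
    by rewrite -card_hypervertices subset_leq_card// subUset !HG_component_sub.
  have := big _ aH a1; have := big _ bH b1.
  set A := #|_ :|: _|; set I := #|_ :&: _|.
  set x := #|HG_component k Y a|; set y := #|HG_component k Y b|.
  by clear; lia.
exact: HG_component_meet ca cb.
Qed.

Lemma no_midsize_connected Y : ~~ midsize_component k Y ->
  #|[set a | isolated_hypervertex k Y a]| = 0 -> HG_connected k Y.
Proof.
move=> mid /eqP; rewrite cards_eq0 => /eqP iso0.
have iso c : ~~ isolated_hypervertex k Y c.
  by have := in_set0 c; rewrite -iso0 inE => ->.
apply/forall_inP => a aH; apply/forall_inP => b bH.
have := HG_component_self Y bH.
by rewrite -(big_components_eq mid aH bH (iso a) (iso b)) inE => /andP[].
Qed.

(** All non-isolated hypervertices share one component, which therefore misses at most the isolated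
    ones. The strict bound on their number provides a non-isolated hypervertex to start from. *)
Lemma no_midsize_giant (R : realType) (eps : R) Y : ~~ midsize_component k Y ->
    #|[set a | isolated_hypervertex k Y a]| < 'C(n, k) ->
    (#|[set a | isolated_hypervertex k Y a]|%:R <= eps * 'C(n, k)%:R)%R ->
  giant_and_isolated k eps Y.
Proof.
move=> mid isoN isoeps; set I := [set a | _] in isoN isoeps *.
have IH : I \subset hypervertices k n.
  by apply/subsetP => a; rewrite inE => /andP[].
have [a aH aI] : exists2 a, a \in hypervertices k n & a \notin I.
  apply/subsetPn; apply/negP => /subset_leq_card.
  by rewrite card_hypervertices leqNgt isoN.
have nI c : c \notin I -> ~~ isolated_hypervertex k Y c by rewrite inE.
have HD : hypervertices k n :\: I \subset HG_component k Y a.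
  apply/subsetP => b; rewrite in_setD => /andP[bI bH].
  rewrite (big_components_eq mid aH bH (nI _ aI) (nI _ bI)).
  exact: HG_component_self.
apply/existsP; exists a; rewrite aH /=; apply/andP; split.
  have /(congr1 (fun m => m%:R : R)%R) := cardsDS IH.
  rewrite natrB ?subset_leq_card// => HI.
  apply: (@Order.POrderTheory.le_trans _ _ (#|hypervertices k n :\: I|%:R)%R).
    by rewrite HI mulrBl mul1r lerD2l lerN2 card_hypervertices.
  by rewrite ler_nat subset_leq_card.
apply/forall_inP => b bH; case: (boolP (b \in I)) => bI.
  by rewrite inE in bI; rewrite bI orbT.
by rewrite (subsetP HD)// in_setD bI.
Qed.

End large_components.

(** * Products of Bernoulli laws *)

Local Open Scope ring_scope.

Section bernoulli_product.
Context (R : realType) (T : finType).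
Implicit Types (q x : T -> R) (Y V D t : {set T}).

(** The law of a random subset with independent memberships; [complex_pmf] is the case of
    [face_prob]. *)
Definition bprod q Y : R := \prod_s bernoulli_pmf (q s) (s \in Y).

Lemma bprod_ge0 q Y : (forall s, 0 <= q s <= 1) -> 0 <= bprod q Y.
Proof. by move=> q01; apply: prodr_ge0 => s _; exact: bernoulli_pmf_ge0. Qed.

Lemma bprod_avoid q D :
  \sum_(Y : {set T} | [disjoint D & Y]) bprod q Y = \prod_(s in D) (1 - q s).
Proof.
rewrite [RHS]big_mkcond /=.
(* Distributing this product gives one term for each Y; the zeros put in place of q on D kill the
   terms where Y meets D. *)
transitivity (\prod_s ((if s \in D then 0 else q s) + (1 - q s))); last first.
  by apply: eq_bigr => s _; case: ifP; rewrite ?add0r// addrC subrK.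
rewrite bigA_distr big_mkcond; apply: eq_bigr => Y _; case: ifPn => DY.
  apply: eq_bigr => s _; case: ifPn => sY //=.
  by case: ifP => // sD; rewrite (disjointFr DY sD) in sY.
have [s sD sY] : exists2 s, s \in D & s \in Y.
  by move: DY => /pred0Pn[s /andP[sD sY]]; exists s.
by rewrite (bigD1 s)//= sY sD mul0r.
Qed.

(* Law of the random subset [V] of [Y] that keeps each [s] with probability
   [x s]. *)
Definition thin x Y V : R :=
  \prod_s (if s \in V then if s \in Y then x s else 0
           else if s \in Y then 1 - x s else 1).

Lemma thin_ge0 x Y V : (forall s, 0 <= x s <= 1) -> 0 <= thin x Y V.
Proof.
move=> x01; apply: prodr_ge0 => s _; have /andP[x0 x1] := x01 s.
by do 2 case: ifP => // _; rewrite subr_ge0.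
Qed.

Lemma thin_eq0 x Y V : ~~ (V \subset Y) -> thin x Y V = 0.
Proof.
by move=> /subsetPn[s sV sY]; rewrite /thin (bigD1 s)//= sV (negbTE sY) mul0r.
Qed.

Lemma thin_sum x Y t : t \subset Y ->
  \sum_(V : {set T} | t \subset V) thin x Y V = \prod_(s in t) x s.
Proof.
move=> /subsetP tY; rewrite [RHS]big_mkcond /=.
transitivity (\prod_s ((if s \in Y then x s else 0) +
    (if s \in t then 0 else if s \in Y then 1 - x s else 1))); last first.
  apply: eq_bigr => s _; case: (boolP (s \in t)) => [/tY ->|_]; first by rewrite addr0.
  by case: ifP; rewrite ?add0r// addrC subrK.
rewrite bigA_distr big_mkcond; apply: eq_bigr => V _; case: ifPn => tV.
  apply: eq_bigr => s _; case: ifPn => sV //=.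
  by case: (boolP (s \in t)) => // /(subsetP tV); rewrite (negbTE sV).
have [s st sV] := subsetPn tV.
by rewrite (bigD1 s)//= (negbTE sV) st mul0r.
Qed.

(** Thinning an independent random set leaves it independent: s survives when it is drawn and then
    kept. *)
Lemma bprod_thin q x V :
  \sum_(Y : {set T}) bprod q Y * thin x Y V = bprod (fun s => q s * x s) V.
Proof.
transitivity (\prod_s (q s * (if s \in V then x s else 1 - x s) +
    (1 - q s) * (if s \in V then 0 else 1))).
  rewrite bigA_distr; apply: eq_bigr => Y _; rewrite -big_split/=.
  by apply: eq_bigr => s _; case: (s \in Y); case: (s \in V).
apply: eq_bigr => s _; case: (s \in V) => /=; rewrite ?mulr0 ?addr0//.
by ring.
Qed.

(** Draw Y and thin it to V. Given A Y, the witness t survives with probability at least c, and then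
    B V holds. *)
Lemma bprod_thin_ge q x (A B : pred {set T}) c :
    (forall s, 0 <= q s <= 1) -> (forall s, 0 <= x s <= 1) ->
    (forall Y : {set T}, A Y -> exists t : {set T}, [/\ t \subset Y, c <= \prod_(s in t) x s &
      forall V : {set T}, t \subset V -> V \subset Y -> B V]) ->
  c * \sum_(Y : {set T} | A Y) bprod q Y <= \sum_(V : {set T} | B V) bprod (fun s => q s * x s) V.
Proof.
move=> q01 x01 AB.
under [leRHS]eq_bigr do rewrite -bprod_thin.
rewrite exchange_big/= mulr_sumr big_mkcond; apply: ler_sum => Y _.
rewrite -mulr_sumr; case: ifPn => [/AB[t [tY ct tB]]|_]; last first.
  by rewrite mulr_ge0 ?bprod_ge0 ?sumr_ge0// => V _; exact: thin_ge0.
rewrite mulrC ler_wpM2l ?bprod_ge0//; apply: le_trans ct _.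
rewrite -(thin_sum _ tY) big_mkcond [leRHS]big_mkcond; apply: ler_sum => V _.
case: ifPn => tV; last by case: ifP => // _; exact: thin_ge0.
case: (boolP (V \subset Y)) => VY; first by rewrite tB.
by rewrite thin_eq0// if_same.
Qed.

(** Coupling: thinning with x = q' / q turns the law for q into the law for q' and yields a subset,
    so an increasing event holding after thinning held before. Where q s = 0, also q' s = 0, and the
    convention for division by 0 gives x s = 0. *)
Lemma bprod_monotone q q' (A : pred {set T}) :
    (forall s, 0 <= q s <= 1) -> (forall s, 0 <= q' s <= q s) ->
    (forall Y V : {set T}, V \subset Y -> A V -> A Y) ->
  \sum_(Y : {set T} | A Y) bprod q' Y <= \sum_(Y : {set T} | A Y) bprod q Y.
Proof.
move=> q01 q'q Aup; pose x s := q' s / q s.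
have x01 s : 0 <= x s <= 1.
  have /andP[q0 _] := q01 s; have /andP[q'0 le] := q'q s.
  rewrite /x divr_ge0//=; have [->|qn0] := eqVneq (q s) 0.
    by rewrite invr0 mulr0.
  by rewrite ler_pdivrMr ?mul1r// lt_neqAle eq_sym qn0.
have q'E : q' =1 (fun s => q s * x s).
  move=> s; rewrite /x mulrC; have [q0|qn0] := eqVneq (q s) 0.
    by have := q'q s; rewrite q0 mulr0 => /le_anti ->.
  by rewrite divfK.
under eq_bigr => Y _.
  rewrite (_ : bprod q' Y = bprod (fun s => q s * x s) Y); last first.
    by apply: eq_bigr => s _; rewrite q'E.
  rewrite -bprod_thin; over.
rewrite exchange_big/= [leRHS]big_mkcond; apply: ler_sum => Y _.
rewrite -mulr_sumr; case: ifPn => AY.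
  rewrite -[leRHS]mulr1 ler_wpM2l ?bprod_ge0//.
  rewrite (_ : 1 = \prod_(s in (set0 : {set T})) x s); last by rewrite big_set0.
  rewrite -(@thin_sum x Y set0) ?sub0set//.
  rewrite big_mkcond [leRHS]big_mkcond; apply: ler_sum => V _.
  by rewrite sub0set; case: ifP => // _; exact: thin_ge0.
rewrite big1 ?mulr0// => V AV; rewrite thin_eq0//.
by apply: contra AY => /Aup; exact.
Qed.

(** On D a set Y disjoint from D sees only the factors 1 - q s, each of which is traded for r * (1 -
    q' s). *)
Lemma bprod_retune q q' r D Y : (forall s, 0 <= q' s <= 1) ->
    (forall s, 0 <= q s <= 1) -> 0 <= r ->
    (forall s, s \notin D -> q s = q' s) ->
    (forall s, s \in D -> 1 - q s <= r * (1 - q' s)) ->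
    [disjoint D & Y] ->
  bprod q Y <= r ^+ #|D| * bprod q' Y.
Proof.
move=> q'01 q01 r0 qq' qD DY.
rewrite -prodr_const big_mkcond -big_split/=; apply: ler_prod => s _.
rewrite bernoulli_pmf_ge0//=; case: ifPn => sD; last by rewrite qq'// mul1r.
by rewrite (disjointFr DY sD)/=; exact: qD.
Qed.

End bernoulli_product.

(** * The random hypergraph *)

Section random_hypergraph.
Context (R : realType) (k n : nat).
Implicit Types (p : R) (Y : faces n) (a b : {set 'I_n}) (S : {set {set 'I_n}}).

(** A real finite sum to compute with; [random_complexE] identifies it with the measure. *)
Definition prob p (A : pred (faces n)) : R :=
  \sum_(Y : faces n | A Y) complex_pmf k p Y.

Lemma random_complexE p (A : pred (faces n)) :
  random_complex k n p [set Y : faces n | A Y]%classic = (prob p A)%:E.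
Proof.
rewrite /random_complex /prob fsbig_finite//= sumEFin -[in RHS]big_filter.
congr EFin; apply: perm_big; apply: uniq_perm => [||Y].
- exact: finmap.fset_uniq.
- by rewrite filter_uniq// index_enum_uniq.
- rewrite mem_filter mem_index_enum andbT in_fset_set; last exact: finite_finset.
  by apply/idP/idP => [/set_mem|AY]; last exact/mem_set.
Qed.

Lemma prob_ge0 p A : 0 <= prob p A.
Proof. by apply: sumr_ge0 => Y _; exact: complex_pmf_ge0. Qed.

Lemma le_prob p (A B : pred (faces n)) : (forall Y, A Y -> B Y) ->
  prob p A <= prob p B.
Proof.
move=> AB; rewrite /prob big_mkcond [leRHS]big_mkcond; apply: ler_sum => Y _.
by case: ifPn => [/AB ->//|_]; case: ifP => // _; exact: complex_pmf_ge0.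
Qed.

Lemma probT p : prob p predT = 1.
Proof. exact: complex_pmf_sum. Qed.

Lemma prob_le1 p A : prob p A <= 1.
Proof. by rewrite -(probT p); exact: le_prob. Qed.

Lemma probC p A : prob p (predC A) = 1 - prob p A.
Proof.
rewrite -[X in _ = X - _](probT p) /prob [X in _ = X - _](bigID A)/=.
by rewrite [X in _ = X - _]addrC addrK.
Qed.

Lemma probU_le p (A B : pred (faces n)) :
  prob p (predU A B) <= prob p A + prob p B.
Proof.
rewrite /prob !(big_mkcond _ (complex_pmf k p)) -big_split/=.
apply: ler_sum => Y _; have := complex_pmf_ge0 k p Y => w0.
by rewrite /=; case: (A Y); case: (B Y) => /=; lra.
Qed.

Lemma prob_exists_le p (I : finType) (P : pred I) (A : I -> pred (faces n)) :
  prob p (fun Y => [exists i, P i && A i Y]) <= \sum_(i | P i) prob p (A i).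
Proof.
rewrite /prob; under [leRHS]eq_bigr do rewrite big_mkcond.
rewrite exchange_big/= big_mkcond; apply: ler_sum => Y _.
have w0 (i : I) : 0 <= (if A i Y then complex_pmf k p Y else 0).
  by case: ifP => // _; exact: complex_pmf_ge0.
case: ifPn => [/existsP[i /andP[Pi Ai]]|_]; last exact: sumr_ge0.
by rewrite (bigD1 i)//= Ai lerDl; apply: sumr_ge0 => j _.
Qed.

Lemma trunc01_id p : 0 <= p <= 1 -> trunc01 p = p.
Proof.
move=> /andP[p0 p1]; rewrite /trunc01.
by rewrite min_l// max_r.
Qed.

Lemma trunc01_le p p' : p <= p' -> trunc01 p <= trunc01 p'.
Proof.
move=> pp'; rewrite /trunc01.
rewrite ge_max !le_max lexx /=; apply/orP; right.
by rewrite le_min !ge_min pp' lexx orbT.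
Qed.

Lemma prob_monotone p p' (A : pred (faces n)) : p <= p' ->
    (forall Y V : faces n, (V : {set _}) \subset (Y : {set _}) -> A V -> A Y) ->
  prob p A <= prob p' A.
Proof.
move=> pp' Aup; apply: (@bprod_monotone R _ (face_prob k p') (face_prob k p)) => //.
  by move=> s; exact: face_prob01.
move=> s; have /andP[-> _] /= := face_prob01 k p s.
by rewrite /face_prob; do 2 case: ifP => // _; exact: trunc01_le.
Qed.

Lemma component_eq_prob p a S : 0 <= p <= 1 -> a \in hypervertices k n ->
  prob p (fun Y => HG_component k Y a == S) <=
  4 ^+ #|S| * expR (- (3 / 4 * p)) ^+ #|split_faces k S| *
    prob (p / 4) (fun Y => HG_component k Y a == S).
Proof.
move=> /andP[p0 p1] aH; set D := split_faces k S; set r := expR _.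
pose q s := @face_prob R k n p s.
(* Only the (k+1)-sets off D are thinned. Those in D are treated afterwards by changing their
   parameter from p to p / 4. *)
pose x (s : {set 'I_n}) : R := if (#|s| == k.+1) && (s \notin D) then 4^-1 else 1.
have q01 s : 0 <= q s <= 1 by exact: face_prob01.
have x01 s : 0 <= x s <= 1 by rewrite /x; case: ifP => _; lra.
have tp : trunc01 p = p by rewrite trunc01_id ?p0.
have tp4 : trunc01 (p / 4) = p / 4 by rewrite trunc01_id//; lra.
rewrite -mulrA -ler_pdivrMl ?exprn_gt0// -exprVn.
have thinned : 4^-1 ^+ #|S| * prob p (fun Y => HG_component k Y a == S) <=
    \sum_(V : {set {set 'I_n}} | HG_component k (V : faces n) a == S)
       bprod (fun s => q s * x s) V.
  (* A spanning t has fewer than #|S| faces, so it survives with probability at least 4^-#|S|, and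
     then the component of a is unchanged. *)
  apply: bprod_thin_ge => // Y /eqP YS.
  have [t [tY tS St]] := HG_component_spanning Y aH.
  exists t; split=> //.
    apply: (@le_trans _ _ (4^-1 ^+ #|(t : {set _})|)).
      by rewrite -YS; apply: ler_wiXn2l; [lra | lra | exact: ltnW].
    rewrite -prodr_const; apply: ler_prod => s _.
    by rewrite /x; case: ifP => _; lra.
  by move=> V tV VY; apply/eqP; rewrite (@HG_component_between _ _ Y t).
apply: le_trans thinned _; rewrite mulr_sumr; apply: ler_sum => V /eqP VS.
apply: bprod_retune => //.
- by move=> s; exact: face_prob01.
- move=> s; have /andP[q0 q1] := q01 s; have /andP[x0 x1] := x01 s.
  by rewrite mulr_ge0//= mulr_ile1.
- exact: expR_ge0.
- move=> s sD; rewrite /q /x /face_prob tp tp4 sD andbT.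
  case: (leqP #|s| k) => sk; last by case: eqP => // _; rewrite mul0r.
  by rewrite (_ : (#|s| == k.+1) = false) ?mulr1//; apply/eqP; lia.
- move=> s sD; have sk : #|s| = k.+1 by move: sD; rewrite !inE => /andP[/andP[/eqP]].
  rewrite /q /x /face_prob tp tp4 sD andbF sk eqxx ltnn mulr1.
  (* The claim is 1 - p <= r (1 - p / 4); it holds since r >= 1 - 3p/4 and (1 - 3p/4)(1 - p/4) = 1 -
     p + 3p^2/16. *)
  have := expR_ge1Dx (- (3 / 4 * p)); rewrite -/r => rp.
  by nra.
- rewrite disjoint_subset; apply/subsetP => s; rewrite /D -VS.
  exact: HG_component_split.
Qed.

(** The events that the component equals S are disjoint, so their probabilities at p / 4 sum to at
    most 1 and the number of families S never enters. *)
Lemma component_card_prob p a s (d : R) : 0 <= p <= 1 -> a \in hypervertices k n ->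
    (forall S, S \subset hypervertices k n -> #|S| = s ->
      d <= #|split_faces k S|%:R) ->
  prob p (fun Y => #|HG_component k Y a| == s) <=
  4 ^+ s * expR (- (3 / 4 * p * d)).
Proof.
move=> p01 aH ds; have /andP[p0 p1] := p01.
pose P S := (S \subset hypervertices k n) && (#|S| == s).
have part q : prob q (fun Y => #|HG_component k Y a| == s) =
    \sum_(S | P S) prob q (fun Y => HG_component k Y a == S).
  rewrite /prob (partition_big (fun Y => HG_component k Y a) P)/=; last first.
    by move=> Y Ys; rewrite /P HG_component_sub.
  apply: eq_bigr => S /andP[_ Ss]; apply: eq_bigl => Y.
  by case: (HG_component k Y a =P S) => [->|_]; rewrite ?Ss ?eqxx ?andbF.
rewrite part; apply: (@le_trans _ _ (\sum_(S | P S)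
    4 ^+ s * expR (- (3 / 4 * p * d)) *
    prob (p / 4) (fun Y => HG_component k Y a == S))).
  apply: ler_sum => S /andP[SH /eqP Ss].
  apply: le_trans (component_eq_prob _ p01 aH) _; rewrite Ss.
  rewrite ler_wpM2r ?prob_ge0// ler_wpM2l ?exprn_ge0//.
  rewrite -expRM_natl ler_expR mulrN lerN2 mulrC ler_wpM2r//; last exact: ds.
  by lra.
by rewrite -mulr_sumr -part -[leRHS]mulr1 ler_wpM2l ?prob_le1.
Qed.

Lemma midsize_prob p : prob p (@midsize_component k n) <=
  \sum_(a in hypervertices k n) \sum_(s < ('C(n, k)./2).+1 | (1 < s)%N)
    prob p (fun Y => #|HG_component k Y a| == s).
Proof.
apply: le_trans (prob_exists_le _ _ _) _; apply: ler_sum => a _.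
apply: le_trans (prob_exists_le _ _ _); apply: le_prob => Y /andP[C1 CN].
apply/existsP; have CN' : (#|HG_component k Y a| < ('C(n, k)./2).+1)%N by [].
by exists (Ordinal CN'); rewrite C1 eqxx.
Qed.

Definition isolated_bin_moment p r : R :=
  \sum_(Y : faces n) complex_pmf k p Y *
    'C(#|[set a | isolated_hypervertex k Y a]|, r)%:R.

(** The binomial coefficient counts the r-families of isolated hypervertices, and a family S is
    isolated exactly when all its cofaces are missing. *)
Lemma isolated_bin_momentE p r : 0 <= p <= 1 ->
  isolated_bin_moment p r =
  \sum_(S : {set {set 'I_n}} | (S \subset hypervertices k n) && (#|S| == r))
    (1 - p) ^+ #|cofaces k S|.
Proof.
move=> p01.
transitivity (\sum_(Y : faces n) \sum_(S : {set {set 'I_n}} | (S \subset hypervertices k n) && (#|S| == r))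
    (if [disjoint cofaces k S & (Y : {set _})] then complex_pmf k p Y else 0)).
  apply: eq_bigr => Y _; rewrite -cards_draws -sum1_card natr_sum mulr_sumr.
  rewrite big_mkcond [RHS]big_mkcond; apply: eq_bigr => S _; rewrite inE mulr1.
  case: (boolP (S \subset hypervertices k n)) => SH /=.
    by rewrite cofaces_isolated//; case: (_ == r); rewrite ?andbF// andbT.
  case: ifP => // /andP[Siso _]; move/negP: SH; case.
  by apply: subset_trans Siso _; apply/subsetP => a; rewrite inE => /andP[].
rewrite exchange_big/=; apply: eq_bigr => S _.
rewrite -big_mkcond/=; rewrite [LHS](bprod_avoid (face_prob k p)).
rewrite -prodr_const; apply: eq_bigr => s; rewrite inE => /andP[/eqP sk _].
by rewrite /face_prob sk ltnn eqxx trunc01_id.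
Qed.

(** A family of r hypervertices has at most r(n - k) cofaces, by the union bound, and at least r(n -
    k) - r^2, by the private ones. The first count gives this bound, the second the matching upper
    bound. *)
Lemma isolated_bin_moment_ge p r : 0 <= p <= 1 ->
  'C('C(n, k), r)%:R * (1 - p) ^+ (r * (n - k)) <=
  isolated_bin_moment p r.
Proof.
move=> p01; rewrite isolated_bin_momentE// -(card_hypervertices k n) -cards_draws.
rewrite -sum1_card natr_sum mulr_suml; under eq_bigl do rewrite inE.
apply: ler_sum => S /andP[SH /eqP Sr].
by rewrite mul1r -Sr ler_wiXn2l ?card_cofaces_le//; lra.
Qed.

Lemma isolated_bin_moment_le p r : 0 <= p <= 1 ->
  isolated_bin_moment p r <=
  'C('C(n, k), r)%:R * (1 - p) ^+ (r * (n - k) - r ^ 2).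
Proof.
move=> p01; rewrite isolated_bin_momentE// -(card_hypervertices k n) -cards_draws.
rewrite -sum1_card natr_sum mulr_suml; under [leRHS]eq_bigl do rewrite inE.
apply: ler_sum => S /andP[SH /eqP Sr].
rewrite mul1r -Sr ler_wiXn2l//; [lra..|].
rewrite leq_subLR addnC; apply: leq_trans (card_private_cofaces SH) _.
by rewrite leq_add2r subset_leq_card// private_cofaces_sub.
Qed.

End random_hypergraph.

(** * Bonferroni inequalities *)

Lemma bin_mul_trinomial X j i : ('C(X, j + i) * 'C(j + i, j) = 'C(X, j) * 'C(X - j, i))%N.
Proof.
have [Xj|jX] := ltnP X j.
  by rewrite (bin_small Xj) (@bin_small X (j + i)) ?mul0n//; lia.
have [Xji|jiX] := ltnP X (j + i).
  by rewrite (bin_small Xji) [in RHS](@bin_small (X - j)) ?muln0//; lia.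
have e1 := bin_fact jiX.
have e2 := bin_fact (leq_addr i j).
have e3 := bin_fact jX.
have iX : (i <= X - j)%N by lia.
have e4 := bin_fact iX.
rewrite addKn in e2.
have f1 := fact_gt0 j; have f2 := fact_gt0 i; have f3 := fact_gt0 (X - (j + i)).
rewrite -subnDA in e4.
apply/eqP; rewrite -(eqn_pmul2r f1) -(eqn_pmul2r f2) -(eqn_pmul2r f3); apply/eqP.
transitivity ('C(X, j + i) * ('C(j + i, j) * (j`! * i`!) * (X - (j + i))`!))%N.
  by ring.
rewrite e2 e1 -e3 -e4; ring.
Qed.

Lemma alternating_bin_sum (R : comNzRingType) y m :
  \sum_(i < m.+1) (-1) ^+ i * 'C(y.+1, i)%:R = (-1) ^+ m * 'C(y, m)%:R :> R.
Proof.
elim: m => [|m IH]; first by rewrite big_ord1 !bin0.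
by rewrite big_ord_recr/= IH binS natrD exprS; ring.
Qed.

(** The trinomial identity factors 'C(X, j) out of every term, which reduces the claim to j = 0 with
    X - j in place of X. There the truncated alternating sum is a single binomial coefficient up to
    sign, and Pascal's rule bounds it by the first omitted term. *)
Lemma bonferroni (R : realDomainType) X j m :
  `|(X == j)%:R - \sum_(i < m) (-1) ^+ i * 'C(j + i, j)%:R * 'C(X, j + i)%:R|
  <= 'C(j + m, j)%:R * 'C(X, j + m)%:R :> R.
Proof.
have E i : 'C(j + i, j)%:R * 'C(X, j + i)%:R = 'C(X, j)%:R * 'C(X - j, i)%:R :> R.
  by rewrite -!natrM mulnC bin_mul_trinomial.
rewrite E; under eq_bigr do rewrite -mulrA E mulrCA; rewrite -mulr_sumr.
have [Xj|jX] := ltnP X j.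
  by rewrite bin_small// !mul0r subr0 (_ : (X == j) = false) ?normr0//; apply/eqP; lia.
have -> : (X == j)%:R = 'C(X, j)%:R * (X - j == 0)%N%:R :> R.
  have [->|Xj] := eqVneq X j; first by rewrite binn subnn mulr1.
  by rewrite (_ : (X - j == 0)%N = false) ?mulr0//; apply/eqP; move/eqP: Xj; lia.
rewrite -mulrBr normrM ger0_norm// ler_wpM2l//.
case: m => [|m]; first by rewrite big_ord0 subr0 bin0 normr_nat lern1 leq_b1.
case: (X - j)%N => [|y] /=.
  by rewrite big_ord_recl bin0 big1 ?addr0 ?mulr1 ?subrr ?normr0// => i _; rewrite bin0n mulr0.
rewrite alternating_bin_sum sub0r normrN normrM normrX normrN1 expr1n mul1r.
by rewrite normr_nat ler_nat binS leq_addl.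
Qed.

Lemma prob_bonferroni (R : realType) k n (p : R) j m :
  `|prob k p (fun Y : faces n => #|[set a | isolated_hypervertex k Y a]| == j) -
    \sum_(i < m) (-1) ^+ i * 'C(j + i, j)%:R *
      isolated_bin_moment k n p (j + i)|
  <= 'C(j + m, j)%:R * isolated_bin_moment k n p (j + m).
Proof.
pose X (Y : faces n) := #|[set a | isolated_hypervertex k Y a]|.
have -> : prob k p (fun Y => X Y == j) = \sum_Y complex_pmf k p Y * (X Y == j)%:R.
  rewrite /prob big_mkcond; apply: eq_bigr => Y _.
  by case: eqP => _; rewrite ?mulr1 ?mulr0.
have -> : \sum_(i < m) (-1) ^+ i * 'C(j + i, j)%:R * isolated_bin_moment k n p (j + i) =
    \sum_Y complex_pmf k p Y *
      \sum_(i < m) (-1) ^+ i * 'C(j + i, j)%:R * 'C(X Y, j + i)%:R.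
  under eq_bigr do rewrite mulr_sumr.
  rewrite exchange_big/=; apply: eq_bigr => Y _; rewrite mulr_sumr.
  by apply: eq_bigr => i _; rewrite mulrCA.
rewrite -sumrB; apply: le_trans (ler_norm_sum _ _ _) _.
rewrite mulr_sumr; apply: ler_sum => Y _; have w0 := complex_pmf_ge0 k p Y.
rewrite -mulrBr normrM (ger0_norm w0) mulrCA ler_wpM2l//.
exact: bonferroni.
Qed.

(** * Asymptotics *)

Local Open Scope classical_set_scope.

Section limits.
Context (R : realType).
Implicit Types (c : R) (k r : nat).

Lemma cvg_ln_natr : (ln n%:R : R) @[n --> \oo] --> +oo.
Proof.
apply/cvgryPge => A; near=> n.
rewrite -[A]expRK ler_ln ?posrE ?expR_gt0//; last first.
  apply: lt_le_trans (expR_gt0 A) _.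
  by near: n; exact: nbhs_infty_ger.
by near: n; exact: nbhs_infty_ger.
Unshelve. all: by end_near. Qed.

Lemma cvg_invy (u : nat -> R) : u @ \oo --> +oo -> (u n)^-1 @[n --> \oo] --> 0.
Proof.
move=> uy; apply/gtr0_cvgV0 => //.
by move/cvgryPgt : uy; exact.
Qed.

(** The cubic term of the exponential series gives (ln n)^3 / 6 <= n, so the quotient is at most 6 /
    ln n. *)
Lemma cvg_ln2_div : (ln n%:R ^+ 2 / n%:R : R) @[n --> \oo] --> 0.
Proof.
have lnV : (6 * (ln n%:R)^-1 : R) @[n --> \oo] --> 0.
  rewrite -[X in _ --> X](mulr0 6); apply: cvgM; first exact: cvg_cst.
  exact: cvg_invy cvg_ln_natr.
apply: (squeeze_cvgr _ (cvg_cst 0) lnV); near=> n.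
have L0 : 0 < ln n%:R :> R by near: n; move/cvgryPgt: cvg_ln_natr; exact.
have n0 : 0 < n%:R :> R by rewrite ltr0n; near: n; exists 1%N.
have := @expR_ge1Dxn R _ 2 (ltW L0); rewrite lnK ?posrE//.
rewrite (_ : 3`!%:R = 6 :> R)// => Ln.
apply/andP; split; first by rewrite mulr_ge0 ?exprn_ge0 ?invr_ge0 ?ltW.
rewrite ler_pdivrMr// mulrAC ler_pdivlMr//.
rewrite -exprSr; have : ln n%:R ^+ 3 / 6 <= n%:R :> R by lra.
by rewrite ler_pdivrMr// mulrC.
Unshelve. all: by end_near. Qed.

Lemma cvg_ln_div : (ln n%:R / n%:R : R) @[n --> \oo] --> 0.
Proof.
apply: (squeeze_cvgr _ (cvg_cst 0) cvg_ln2_div); near=> n.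
have L0 : 1 < ln n%:R :> R by near: n; move/cvgryPgt: cvg_ln_natr; exact.
have n0 : 0 < n%:R :> R by rewrite ltr0n; near: n; exists 1%N.
apply/andP; split; first by rewrite mulr_ge0 ?invr_ge0 ?ltW//; lra.
by rewrite ler_pM2r ?invr_gt0// expr2 ler_peMr; lra.
Unshelve. all: by end_near. Qed.

Lemma cvg_natV : (n%:R^-1 : R) @[n --> \oo] --> 0.
Proof. exact: cvg_invy cvgr_idn. Qed.

Section edge_probability.
Variables (k : nat) (c : R).
Let p (n : nat) : R := (k%:R * ln n%:R + c) / n%:R.

Lemma cvg_p : p n @[n --> \oo] --> 0.
Proof.
rewrite (_ : p = fun n => k%:R * (ln n%:R / n%:R) + c * n%:R^-1); last first.
  by apply/funext => n; rewrite /p mulrDl mulrA.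
rewrite -[X in _ --> X]addr0; apply: cvgD.
  rewrite -[X in _ --> X](mulr0 k%:R); apply: cvgM; first exact: cvg_cst.
  exact: cvg_ln_div.
rewrite -[X in _ --> X](mulr0 c); apply: cvgM; first exact: cvg_cst.
exact: cvg_natV.
Qed.

(** This is the order of the error made in replacing (1 - p)^n by exp(-np). *)
Lemma cvg_np2 : (n%:R * p n ^+ 2) @[n --> \oo] --> 0.
Proof.
have lim : (k%:R ^+ 2 * (ln n%:R ^+ 2 / n%:R) +
    2 * k%:R * c * (ln n%:R / n%:R) + c ^+ 2 * n%:R^-1) @[n --> \oo] -->
    k%:R ^+ 2 * 0 + 2 * k%:R * c * 0 + c ^+ 2 * 0.
  apply: cvgD; first apply: cvgD; apply: cvgM; try exact: cvg_cst.
  - exact: cvg_ln2_div.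
  - exact: cvg_ln_div.
  - exact: cvg_natV.
rewrite !mulr0 !addr0 in lim; apply: cvg_trans lim; apply: near_eq_cvg; near=> n.
have n0 : n%:R != 0 :> R by rewrite pnatr_eq0 -lt0n; near: n; exists 1%N.
by rewrite /p; field.
Unshelve. all: by end_near. Qed.

Lemma p_small : (0 < k)%N -> \forall n \near \oo, 0 <= p n <= 2^-1.
Proof.
move=> k0; near=> n.
have n0 : 0 < n%:R :> R by rewrite ltr0n; near: n; exists 1%N.
apply/andP; split.
  rewrite /p divr_ge0 ?ltW//.
  have : - c < ln n%:R by near: n; move/cvgryPgt: cvg_ln_natr; exact.
  have : 0 < ln n%:R :> R by near: n; move/cvgryPgt: cvg_ln_natr; exact.
  have : 1 <= k%:R :> R by rewrite ler1n.
  by nra.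
near: n; have /cvgrPdist_le /(_ 2^-1) := cvg_p.
rewrite invr_gt0 ltr0n => /(_ isT); apply: filterS => n.
by rewrite sub0r normrN; apply: le_trans; exact: ler_norm.
Unshelve. all: by end_near. Qed.

(** Here 1 / (1 - x) = 1 + x / (1 - x) <= exp(x / (1 - x)), and x / (1 - x) <= x + 2x^2 because x^2
    (1 - 2x) >= 0. *)
Lemma onem_ge_expR (x : R) : 0 <= x <= 2^-1 -> expR (- (x + 2 * x ^+ 2)) <= 1 - x.
Proof.
move=> x01; have x1 : 0 < 1 - x by lra.
apply: (@le_trans _ _ (expR (- (x / (1 - x))))).
  rewrite ler_expR lerN2 ler_pdivrMr//; nra.
rewrite expRN -[leRHS]invrK lef_pV2 ?posrE ?expR_gt0 ?invr_gt0//.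
apply: le_trans (expR_ge1Dx _).
rewrite le_eqVlt; apply/orP; left; apply/eqP; field; lra.
Qed.

(** Since n^k = exp(k ln n) and n p = k ln n + c, the bounds exp(-(p + 2p^2)) <= 1 - p <= exp(-p)
    squeeze the product between exponentials whose exponents tend to -c. *)
Lemma cvg_isolation : (0 < k)%N ->
  (n%:R ^+ k * (1 - p n) ^+ (n - k)) @[n --> \oo] --> expR (- c).
Proof.
move=> k0.
have cvgE (u : nat -> R) : u @ \oo --> - c -> expR (u n) @[n --> \oo] --> expR (- c).
  by move=> uc; apply: continuous_cvg => //; exact: continuous_expR.
have up : (- c + k%:R * p n) @[n --> \oo] --> - c.
  rewrite -[X in _ --> X]addr0; apply: cvgD; first exact: cvg_cst.
  rewrite -[X in _ --> X](mulr0 k%:R); apply: cvgM; first exact: cvg_cst.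
  exact: cvg_p.
have lo : (- c + k%:R * p n - 2 * (n%:R * p n ^+ 2)) @[n --> \oo] --> - c.
  rewrite -[X in _ --> X]subr0; apply: cvgB => //.
  rewrite -[X in _ --> X](mulr0 2); apply: cvgM; first exact: cvg_cst.
  exact: cvg_np2.
apply: squeeze_cvgr (cvgE _ lo) (cvgE _ up); near=> n.
have n0 : 0 < n%:R :> R by rewrite ltr0n; near: n; exists 1%N.
have kn : (k <= n)%N by near: n; exists k.
have /andP[p0 p2] : 0 <= p n <= 2^-1 by near: n; exact: p_small.
have nk : n%:R ^+ k = expR (k%:R * ln n%:R) :> R.
  by rewrite expRM_natl lnK.
have np : n%:R * p n = k%:R * ln n%:R + c.
  by rewrite /p mulrC divfK// gt_eqF.
have nkE : (n - k)%:R = n%:R - k%:R :> R by rewrite natrB.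
rewrite nk; apply/andP; split.
  have lb : expR (- (p n + 2 * p n ^+ 2)) ^+ (n - k) <= (1 - p n) ^+ (n - k).
    by rewrite lerXn2r ?nnegrE ?expR_ge0 ?onem_ge_expR ?p0//; lra.
  apply: le_trans (ler_wpM2l (expR_ge0 _) lb).
  rewrite -expRM_natl -expRD ler_expR nkE.
  have := sqr_ge0 (p n); have : 0 <= k%:R :> R by [].
  by nra.
have ub : (1 - p n) ^+ (n - k) <= expR (- p n) ^+ (n - k).
  rewrite lerXn2r ?nnegrE ?expR_ge0//; first by lra.
  exact: expR_ge1Dx.
apply: le_trans (ler_wpM2l (expR_ge0 _) ub) _.
by rewrite -expRM_natl -expRD ler_expR nkE; lra.
Unshelve. all: by end_near. Qed.

End edge_probability.

Lemma cvg_bin_ratio r : ('C(n, r)%:R / n%:R ^+ r : R) @[n --> \oo] --> (r`!%:R^-1 : R).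
Proof.
have ff : ((n ^_ r)%:R / n%:R ^+ r : R) @[n --> \oo] --> (1 : R).
  elim: r => [|r IH].
    under eq_fun do rewrite ffactn0 expr0 divr1; exact: cvg_cst.
  have lim : ((n ^_ r)%:R / n%:R ^+ r * (1 - r%:R * n%:R^-1)) @[n --> \oo] -->
      (1 * (1 - r%:R * 0) : R).
    apply: cvgM => //; apply: cvgB; first exact: cvg_cst.
    apply: cvgM; [exact: cvg_cst | exact: cvg_natV].
  rewrite mulr0 subr0 mulr1 in lim; apply: cvg_trans lim; apply: near_eq_cvg; near=> n.
  have n0 : n%:R != 0 :> R by rewrite pnatr_eq0 -lt0n; near: n; exists 1%N.
  have rn : (r <= n)%N by near: n; exists r.
  rewrite ffactnSr natrM natrB// exprSr; field.
  by rewrite n0 expf_neq0.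
rewrite (_ : (fun n => _) = (fun n => (n ^_ r)%:R / n%:R ^+ r * r`!%:R^-1)); last first.
  apply/funext => n; rewrite -bin_ffact natrM mulrAC mulfK// pnatr_eq0 -lt0n fact_gt0.
rewrite -[X in _ --> X]mul1r; apply: cvgM => //; exact: cvg_cst.
Unshelve. all: by end_near. Qed.

(** Interchange of the limits in n and m: fix m first, then let n grow. The error splits into l - U
    m, U m - u m n, and v m n, which is at most |V m| + |V m - v m n|; each of the four parts is
    below e / 4. *)
Lemma cvg_truncated (P : nat -> R) (u v : nat -> nat -> R) (U V : nat -> R) (l : R) :
    (forall m, u m n @[n --> \oo] --> U m) ->
    (forall m, v m n @[n --> \oo] --> V m) ->
    (forall m, \forall n \near \oo, `|P n - u m n| <= v m n) ->
    U @ \oo --> l -> V @ \oo --> (0 : R) -> P @ \oo --> l.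
Proof.
move=> uU vV Pu Ul V0; apply/cvgrPdist_lt => e e0.
have e4 : 0 < e / 4 by rewrite divr_gt0.
have [m [Ulm Vm]] : exists m, `|l - U m| < e / 4 /\ `|V m| < e / 4.
  near \oo => m; exists m; split.
    by near: m; have /cvgrPdist_lt := Ul; exact.
  rewrite -normrN -sub0r.
  by near: m; have /cvgrPdist_lt := V0; exact.
near=> n.
have H1 : `|U m - u m n| < e / 4.
  by near: n; have /cvgrPdist_lt := uU m; exact.
have H2 : `|V m - v m n| < e / 4.
  by near: n; have /cvgrPdist_lt := vV m; exact.
have H3 : `|P n - u m n| <= v m n by near: n; exact: Pu.
move: Ulm Vm H1 H2 H3; rewrite !ltr_norml !ler_norml.
by move=> /andP[? ?] /andP[? ?] /andP[? ?] /andP[? ?] /andP[? ?]; apply/andP; split; lra.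
Unshelve. all: by end_near. Qed.

End limits.

(** * Bounding the probability of a midsize component *)

Lemma bin_le_expn n k : ('C(n, k) <= n ^ k)%N.
Proof.
elim: k => [|k IH]; first by rewrite bin0.
apply: (@leq_trans (k.+1 * 'C(n, k.+1))); first by rewrite leq_pmull.
by rewrite mul_bin_left expnS leq_mul// leq_subr.
Qed.

Lemma sum_split_le (R : realDomainType) K M (P : pred nat) (f : nat -> R) (b b' : R) :
    0 <= b -> 0 <= b' ->
    (forall s, P s -> (s <= M)%N -> f s <= b) ->
    (forall s, P s -> (s < K)%N -> (M < s)%N -> f s <= b') ->
  \sum_(s < K | P s) f s <= M.+1%:R * b + K%:R * b'.
Proof.
move=> b0 b'0 fb fb'; rewrite (bigID (fun s : 'I_K => (s <= M)%N))/=.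
apply: lerD.
  apply: (@le_trans _ _ (\sum_(s < K | P s && (s <= M)%N) b)).
    by apply: ler_sum => s /andP[Ps sM]; exact: fb.
  rewrite sumr_const -[leLHS]mulr_natl ler_wpM2r// ler_nat -[leqRHS]card_ord.
  apply: (@leq_card_in _ _ (fun s : 'I_K => inord s : 'I_M.+1)) => s t.
  rewrite !unfold_in => /andP[_ sM] /andP[_ tM] /(congr1 val) /=.
  by rewrite !inordK// => /val_inj.
apply: (@le_trans _ _ (\sum_(s < K) b')).
  rewrite big_mkcond; apply: ler_sum => s _; case: ifPn => // /andP[Ps].
  by rewrite -ltnNge => Ms; exact: fb'.
by rewrite sumr_const card_ord mulr_natl.
Qed.

(* Beyond this M each size s contributes at most n^-(2k+1), which beats the at
   most n^(2k) pairs (a, s). *)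
Lemma midsize_prob_le (R : realType) k n (p L : R) (M := (4 * k.+1 * (2 * k).+1)%N) :
    (0 < k)%N -> (k + M < n)%N -> 0 <= p <= 1 -> 0 <= L -> n%:R = expR L ->
    9 / 10 * k%:R * L <= p * (n - k - M)%:R ->
    4 <= expR (7 / 80 * L / k.+1%:R) ->
  prob k p (@midsize_component k n) <=
  M.+1%:R * 4 ^+ M * expR (- (7 / 20 * L)) + expR (- L).
Proof.
move=> k0 kMn p01 L0 nL pL L4; have /andP[p0 p1] := p01.
have ME : M%:R = 4 * k.+1%:R * (2 * k).+1%:R :> R by rewrite /M !natrM.
move: ME kMn pL; move: M => M ME kMn pL.
have kn : (k < n)%N by exact: leq_ltn_trans (leq_addr _ _) kMn.
have Mnk : (M <= n - k)%N by move: kMn; clear; lia.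
have k1 : 1 <= k%:R :> R by rewrite ler1n.
have N1 := bin_gt1 k0 kn.
have kn0 : k%:R != 0 :> R by rewrite pnatr_eq0 -lt0n.
have kSn0 : k.+1%:R != 0 :> R by rewrite pnatr_eq0.
have NL : 'C(n, k)%:R <= expR (k%:R * L).
  by rewrite expRM_natl -nL -natrX ler_nat bin_le_expn.
(* Sizes 2 <= s <= M: #|D| >= s(n - k - M) as s^2 <= sM, and 3/4 * 2 * 9/10 = 27/20. *)
set b := 4 ^+ M * expR (- (27 / 20 * k%:R * L)).
set b' := expR (- ((2 * k).+1%:R * L)).
have b0 : 0 <= b by rewrite mulr_ge0 ?expR_ge0.
have b'0 : 0 <= b' by exact: expR_ge0.
have inner a : a \in hypervertices k n ->
    \sum_(s < ('C(n, k)./2).+1 | (1 < s)%N)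
      prob k p (fun Y : faces n => #|HG_component k Y a| == s) <=
    M.+1%:R * b + ('C(n, k)./2).+1%:R * b'.
  move=> aH; apply: (@sum_split_le R _ M (fun s => 1 < s)%N (fun s =>
    prob k p (fun Y : faces n => #|HG_component k Y a| == s))) => // s s1.
    move=> sM; have d (S : {set {set 'I_n}}) : S \subset hypervertices k n -> #|S| = s ->
        (s * (n - k - M))%:R <= #|split_faces k S|%:R :> R.
      move=> SH Ss; rewrite ler_nat; have := card_split_faces_small k0 SH.
      rewrite Ss; have : (s ^ 2 <= s * M)%N by rewrite expnS expn1 leq_mul2l sM orbT.
      have : (s * (n - k) = s * (n - k - M) + s * M)%N by rewrite -mulnDr subnK.
      by clear; lia.
    apply: le_trans (component_card_prob p01 aH d) _.
    apply: ler_pM; rewrite ?exprn_ge0 ?expR_ge0//.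
      by rewrite ler_weXn2l// ler1n.
    rewrite ler_expR lerN2 natrM.
    have s2 : 2 <= s%:R :> R by rewrite ler_nat.
    have kL0 : 0 <= 9 / 10 * k%:R * L by rewrite !mulr_ge0//; lra.
    have := ler_pM (ler0n _ 2) kL0 s2 pL.
    set w := (n - k - M)%:R; set s' := s%:R; lra.
  rewrite ltnS geq_half_double => sN Ms.
  (* For s at most half of N = 'C(n, k), N - s >= N / 2, and dividing the isoperimetric inequality
     by N gives this d. *)
  pose d : R := (n - k)%:R * s%:R / (2 * k%:R * k.+1%:R).
  have dS (S : {set {set 'I_n}}) : S \subset hypervertices k n -> #|S| = s -> d <= #|split_faces k S|%:R.
    move=> SH Ss; have := card_split_faces_isoperimetric kn SH.
    rewrite Ss /d ler_pdivrMr ?mulr_gt0 ?ltr0n// -!natrM ler_nat => iso.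
    have : ('C(n, k) * ((n - k) * s) <=
        'C(n, k) * (#|split_faces k S| * (2 * k * k.+1)))%N.
      apply: (@leq_trans (2 * ((n - k) * s * ('C(n, k) - s)))).
        have NS : ('C(n, k) <= 2 * ('C(n, k) - s))%N by move: sN; clear; lia.
        apply: leq_trans (leq_mul NS (leqnn _)) _.
        by rewrite leq_eqVlt; apply/orP; left; apply/eqP; ring.
      by apply: leq_trans (leq_mul (leqnn 2) iso) _; rewrite leq_eqVlt; apply/orP; left; apply/eqP; ring.
    by rewrite leq_pmul2l// ltnW.
  apply: le_trans (component_card_prob p01 aH dS) _.
  have s4 : 4 ^+ s <= expR (7 / 80 * L / k.+1%:R) ^+ s.
    by rewrite lerXn2r ?nnegrE ?expR_ge0.
  apply: le_trans (ler_wpM2r (expR_ge0 _) s4) _.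
  rewrite -expRM_natl -expRD ler_expR.
  have pd : 9 / 20 * L * s%:R / k.+1%:R <= p * d.
    have wM : (n - k - M)%:R <= (n - k)%:R :> R by rewrite ler_nat leq_subr.
    have pw : 9 / 10 * k%:R * L <= p * (n - k)%:R.
      by apply: le_trans pL _; rewrite ler_wpM2l.
    have -> : p * d = p * (n - k)%:R * (s%:R / (2 * k%:R * k.+1%:R)) by rewrite /d; ring.
    have -> : 9 / 20 * L * s%:R / k.+1%:R =
        9 / 10 * k%:R * L * (s%:R / (2 * k%:R * k.+1%:R)).
      by field; rewrite kn0 andbT addrC natr1.
    by rewrite ler_wpM2r// divr_ge0// !mulr_ge0.
  (* In units of L s / (k + 1), the decay 3/4 * 9/20 = 27/80 minus the 7/80 that pays for 4^s leaves
     1/4. The choice of M makes this at least (2k + 1) L once s > M. *)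
  have Ls : (2 * k).+1%:R * L <= 1 / 4 * L * s%:R / k.+1%:R.
    have Ms' : M%:R <= s%:R :> R by rewrite ler_nat ltnW.
    apply: (@le_trans _ _ (1 / 4 * L * M%:R / k.+1%:R)).
      rewrite ME le_eqVlt; apply/orP; left; apply/eqP.
      by field; rewrite addrC natr1.
    by rewrite ler_wpM2r ?invr_ge0// ler_wpM2l//; lra.
  have -> : s%:R * (7 / 80 * L / k.+1%:R) = 7 / 80 * (L * s%:R / k.+1%:R) by ring.
  have E : 9 / 20 * L * s%:R / k.+1%:R = 9 / 20 * (L * s%:R / k.+1%:R) by ring.
  have E' : 1 / 4 * L * s%:R / k.+1%:R = 1 / 4 * (L * s%:R / k.+1%:R) by ring.
  rewrite E in pd; rewrite E' in Ls.
  move: pd Ls; set x := L * s%:R / _; set y := p * d; set z := _ * L.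
  rewrite -!mulrA -/y; lra.
apply: le_trans (midsize_prob _ _ _) _.
apply: (@le_trans _ _ (\sum_(a in hypervertices k n)
    (M.+1%:R * b + ('C(n, k)./2).+1%:R * b'))).
  by apply: ler_sum => a; exact: inner.
rewrite sumr_const card_hypervertices -[leLHS]mulr_natl mulrDr; apply: lerD.
  (* Small sizes: at most exp(kL) hypervertices against exp(-27/20 kL) leaves exp(-7/20 kL), and k
     >= 1. *)
  rewrite /b [leLHS](_ : _ = M.+1%:R * 4 ^+ M *
    ('C(n, k)%:R * expR (- (27 / 20 * k%:R * L)))); last by ring.
  apply: ler_wpM2l; first by rewrite mulr_ge0 ?exprn_ge0.
  apply: le_trans (ler_wpM2r (expR_ge0 _) NL) _.
  rewrite -expRD ler_expR.
  have : L <= k%:R * L by rewrite ler_peMl.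
  by set x := k%:R * L; rewrite -!mulrA -/x; lra.
have N2 : ('C(n, k)./2).+1%:R <= 'C(n, k)%:R :> R by rewrite ler_nat; move: N1; clear; lia.
(* Large sizes: at most exp(2kL) pairs (a, s) against exp(-(2k + 1)L) leaves exp(-L). *)
apply: (@le_trans _ _ (expR (k%:R * L) * (expR (k%:R * L) * b'))).
  apply: ler_pM; rewrite ?mulr_ge0//.
  apply: ler_pM => //; exact: le_trans N2 NL.
by rewrite -!expRD ler_expR -natr1 natrM; lra.
Qed.

Lemma cvg_sum_ord (R : realType) m (f : nat -> nat -> R) (l : nat -> R) :
  (forall i, f i n @[n --> \oo] --> l i) ->
  (\sum_(i < m) f i n) @[n --> \oo] --> \sum_(i < m) l i.
Proof.
move=> fl; elim: m => [|m IH].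
  by under eq_fun do rewrite big_ord0; rewrite big_ord0; exact: cvg_cst.
under eq_fun do rewrite big_ord_recr; rewrite big_ord_recr/=.
exact: cvgD.
Qed.

Lemma cvg_bin_infty k : (0 < k)%N -> 'C(n, k) @[n --> \oo] --> \oo.
Proof.
case: k => // k _; apply/cvgnyPge => A; near=> n.
have n0 : (0 < n)%N by near: n; exists 1%N.
have kn : (k < n)%N by near: n; exists k.+1.
have An : (k.+1 * A <= n)%N by near: n; exists (k.+1 * A)%N.
rewrite -(@leq_pmul2l k.+1)// -mul_bin_diag; apply: leq_trans An _.
by rewrite leq_pmulr// bin_gt0 -ltnS prednK.
Unshelve. all: by end_near. Qed.

Lemma prob_ltn (R : realType) k n (p : R) (X : faces n -> nat) J :
  prob k p (fun Y : faces n => (X Y < J)%N) = \sum_(j < J) prob k p (fun Y : faces n => X Y == j).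
Proof.
elim: J => [|J IH]; first by rewrite big_ord0 /prob big_pred0.
rewrite big_ord_recr/= -IH /prob (bigID (fun Y : faces n => (X Y < J)%N))/=.
congr (_ + _); apply: eq_bigl => Y; rewrite ltnS; last by rewrite -leqNgt eqn_leq.
by case: ltnP => [/ltnW ->|]; rewrite ?andbF.
Qed.

(** * Limits in the critical window *)

Section critical_window.
Context (R : realType) (k : nat) (c : R).
Hypothesis k_gt0 : (0 < k)%N.
Let p (n : nat) : R := (k%:R * ln n%:R + c) / n%:R.
Let lambda : R := expR (- c) / k`!%:R.
Let X n (Y : faces n) := #|[set a | isolated_hypervertex k Y a]%SET|.

Lemma lambda_gt0 : 0 < lambda.
Proof. by rewrite divr_gt0 ?expR_gt0// ltr0n fact_gt0. Qed.

Lemma p_near01 : \forall n \near \oo, 0 <= p n <= 1.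
Proof.
by apply: filterS (@p_small R k c k_gt0) => n; rewrite -/(p n) => h; lra.
Qed.

Lemma cvg_mean_isolated :
  ('C(n, k)%:R * (1 - p n) ^+ (n - k)) @[n --> \oo] --> lambda.
Proof.
have lim : (n%:R ^+ k * (1 - p n) ^+ (n - k) * ('C(n, k)%:R / n%:R ^+ k))
    @[n --> \oo] --> lambda.
  by apply: cvgM; [exact: cvg_isolation | exact: cvg_bin_ratio].
apply: cvg_trans lim; apply: near_eq_cvg; near=> n.
have n0 : n%:R ^+ k != 0 :> R.
  by rewrite expf_neq0// pnatr_eq0 -lt0n; near: n; exists 1%N.
by rewrite /= mulrC mulrA divfK.
Unshelve. all: by end_near. Qed.

(** With N = 'C(n, k), the lower bound is asymptotic to (N (1 - p)^(n - k))^r / r!. The upper bound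
    differs from it by the factor (1 - p)^(-r^2), which tends to 1 because r is fixed. *)
Lemma cvg_isolated_bin_moment r :
  isolated_bin_moment k n (p n) r @[n --> \oo] --> lambda ^+ r / r`!%:R.
Proof.
have lo : ('C('C(n, k), r)%:R * (1 - p n) ^+ (r * (n - k))) @[n --> \oo] -->
    lambda ^+ r / r`!%:R.
  have ratio : ('C('C(n, k), r)%:R / 'C(n, k)%:R ^+ r : R) @[n --> \oo] -->
      (r`!%:R^-1 : R).
    exact: (cvg_comp _ _ (cvg_bin_infty k_gt0) (@cvg_bin_ratio R r)).
  have pow : (('C(n, k)%:R * (1 - p n) ^+ (n - k)) ^+ r) @[n --> \oo] -->
      lambda ^+ r.
    elim: r {ratio} => [|r IH].
      by under eq_fun do rewrite expr0; rewrite expr0; exact: cvg_cst.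
    under eq_fun do rewrite exprS; rewrite exprS.
    exact: cvgM cvg_mean_isolated IH.
  have lim : (('C(n, k)%:R * (1 - p n) ^+ (n - k)) ^+ r *
      ('C('C(n, k), r)%:R / 'C(n, k)%:R ^+ r)) @[n --> \oo] -->
      lambda ^+ r / r`!%:R.
    exact: cvgM pow ratio.
  apply: cvg_trans lim; apply: near_eq_cvg; near=> n.
  have N0 : 'C(n, k)%:R ^+ r != 0 :> R.
    rewrite expf_neq0// pnatr_eq0 -lt0n bin_gt0.
    by near: n; exists k.
  by rewrite /= exprMn -exprM mulnC mulrAC [X in X * _]mulrC divfK.
have one : ((1 - p n) ^- (r ^ 2)) @[n --> \oo] --> (1 : R).
  have h m : ((1 - p n) ^+ m) @[n --> \oo] --> (1 : R).
    elim: m => [|m IH].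
      by under eq_fun do rewrite expr0; exact: cvg_cst.
    have step : ((1 - p n) * (1 - p n) ^+ m) @[n --> \oo] --> ((1 - 0) * 1 : R).
      by apply: cvgM => //; apply: cvgB; [exact: cvg_cst | exact: cvg_p].
    by rewrite subr0 mulr1 in step; under eq_fun do rewrite exprS.
  rewrite -[X in _ --> X]invr1; apply: cvgV; [exact: oner_neq0 | exact: h].
have up : ('C('C(n, k), r)%:R * (1 - p n) ^+ (r * (n - k)) * (1 - p n) ^- (r ^ 2))
    @[n --> \oo] --> lambda ^+ r / r`!%:R.
  by rewrite -[X in _ --> X]mulr1; exact: cvgM lo one.
apply: squeeze_cvgr lo up; near=> n.
have p01 : 0 <= p n <= 1 by near: n; exact: p_near01.
have p2 : 0 <= p n <= 2^-1 by near: n; exact: p_small.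
rewrite isolated_bin_moment_ge//=.
apply: le_trans (isolated_bin_moment_le k n r p01) _.
have rn : (r ^ 2 <= r * (n - k))%N.
  rewrite expnS expn1 leq_mul2l; apply/orP; right.
  have : (r + k <= n)%N by near: n; exists (r + k)%N.
  by clear; lia.
rewrite -mulrA ler_wpM2l// -[in leRHS](subnK rn) exprD mulfK//.
by rewrite expf_neq0// gt_eqF//; lra.
Unshelve. all: by end_near. Qed.

(** Truncate Bonferroni at m and let n grow: the sum tends to lambda^j / j! times a partial sum of
    the series of exp(-lambda), the error to lambda^j / j! times lambda^m / m!. Then let m grow. *)
Lemma cvg_isolated_eq j :
  prob k (p n) (fun Y : faces n => X Y == j) @[n --> \oo] --> poisson_pmf lambda j.
Proof.
have binE m : 'C(j + m, j)%:R * (lambda ^+ (j + m) / (j + m)`!%:R) =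
    lambda ^+ j / j`!%:R * (lambda ^+ m / m`!%:R) :> R.
  have := bin_fact (leq_addr m j); rewrite addKn => /(congr1 (fun i => i%:R : R)).
  rewrite !natrM => E; rewrite exprD -E.
  have nz i : i`!%:R != 0 :> R by rewrite pnatr_eq0 -lt0n fact_gt0.
  have bz : 'C(j + m, j)%:R != 0 :> R by rewrite pnatr_eq0 -lt0n bin_gt0 leq_addr.
  by field; rewrite bz !nz.
apply: (@cvg_truncated R _
  (fun m n => \sum_(i < m) (-1) ^+ i * 'C(j + i, j)%:R *
     isolated_bin_moment k n (p n) (j + i))
  (fun m n => 'C(j + m, j)%:R * isolated_bin_moment k n (p n) (j + m))
  (fun m => \sum_(i < m) (-1) ^+ i * 'C(j + i, j)%:R *
     (lambda ^+ (j + i) / (j + i)`!%:R))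
  (fun m => 'C(j + m, j)%:R * (lambda ^+ (j + m) / (j + m)`!%:R))).
- move=> m; apply: (@cvg_sum_ord R m (fun i n => (-1) ^+ i * 'C(j + i, j)%:R *
     isolated_bin_moment k n (p n) (j + i)) (fun i => (-1) ^+ i * 'C(j + i, j)%:R *
     (lambda ^+ (j + i) / (j + i)`!%:R))) => i.
  by apply: cvgM; [exact: cvg_cst | exact: cvg_isolated_bin_moment].
- by move=> m; apply: cvgM; [exact: cvg_cst | exact: cvg_isolated_bin_moment].
- by move=> m; apply: nearW => n; exact: prob_bonferroni.
- rewrite /poisson_pmf lambda_gt0 (_ : (fun m => _) = (fun m =>
    lambda ^+ j / j`!%:R * series (exp_coeff (- lambda)) m)); last first.
    apply/funext => m; rewrite /series/= big_mkord mulr_sumr.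
    apply: eq_bigr => i _; rewrite -mulrA binE mulrCA exp_coeffE/=.
    by rewrite [(- lambda) ^+ i]exprNn; ring.
  by apply: cvgM; [exact: cvg_cst | exact: is_cvg_series_exp_coeff].
- have step : (lambda ^+ j / j`!%:R * exp_coeff lambda m) @[m --> \oo] -->
      (lambda ^+ j / j`!%:R * 0 : R).
    by apply: cvgM; [exact: cvg_cst | exact: cvg_exp_coeff].
  by rewrite mulr0 in step; under eq_fun do rewrite binE.
Qed.

Lemma cvg_midsize :
  prob k (p n) (@midsize_component k n) @[n --> \oo] --> (0 : R).
Proof.
pose M := (4 * k.+1 * (2 * k).+1)%N.
have Ly := @cvg_ln_natr R.
have expL (a : R) : 0 < a -> expR (- (a * ln n%:R)) @[n --> \oo] --> (0 : R).
  move=> a0; apply: (cvg_comp (fun n => a * ln n%:R) (fun x : R => expR (- x))); last exact: cvgr_expR.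
  apply/cvgryPge => A; near=> n; rewrite mulrC -ler_pdivrMr//.
  by near: n; move/cvgryPge: Ly; exact.
have up : (M.+1%:R * 4 ^+ M * expR (- (7 / 20 * ln n%:R)) +
    expR (- (1 * ln n%:R))) @[n --> \oo] --> (0 : R).
  rewrite -[X in _ --> X]addr0; apply: cvgD; last exact: expL.
  rewrite -[X in _ --> X](mulr0 (M.+1%:R * 4 ^+ M)); apply: cvgM; first exact: cvg_cst.
  by apply: expL; lra.
have pkM : (p n * (k + M)%:R) @[n --> \oo] --> (0 : R).
  rewrite -[X in _ --> X](mul0r (k + M)%:R); apply: cvgM; last exact: cvg_cst.
  exact: cvg_p.
apply: (squeeze_cvgr _ (cvg_cst 0) up); near=> n.
rewrite prob_ge0 mul1r /=; apply: midsize_prob_le => //.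
- by near: n; exists (k + M).+1.
- by near: n; exact: p_near01.
- by near: n; move/cvgryPge: Ly; exact.
- by rewrite lnK// posrE ltr0n; near: n; exists 1%N.
- have n0 : n%:R != 0 :> R by rewrite pnatr_eq0 -lt0n; near: n; exists 1%N.
  rewrite -subnDA natrB; last by near: n; exists (k + M)%N.
  have -> : p n * (n%:R - (k + M)%:R) = k%:R * ln n%:R + c - p n * (k + M)%:R.
    by rewrite mulrBr /p divfK.
  have : p n * (k + M)%:R <= 1.
    near: n; have /cvgrPdist_le /(_ 1 ltr01) := pkM; apply: filterS => n.
    by rewrite sub0r normrN; apply: le_trans; exact: ler_norm.
  (* The quantity to bound is at least k ln n + c - 1, and 1 - c <= ln n / 10 <= k ln n / 10. *)
  have : 10 * (1 - c) <= ln n%:R by near: n; move/cvgryPge: Ly; exact.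
  have : 0 <= ln n%:R :> R by near: n; move/cvgryPge: Ly; exact.
  have : 1 <= k%:R :> R by rewrite ler1n.
  by clear; nra.
- rewrite -[leLHS](@lnK R) ?posrE// ler_expR ler_pdivlMr// -ler_pdivrMl; last lra.
  by near: n; move/cvgryPge: Ly; exact.
Unshelve. all: by end_near. Qed.

(** Connectedness forces the absence of isolated hypervertices, and the converse fails only if a
    midsize component exists; so the limit is the Poisson mass at 0. *)
Lemma cvg_connected :
  prob k (p n) (@HG_connected k n) @[n --> \oo] --> expR (- lambda).
Proof.
have P0 := @cvg_isolated_eq 0%N.
rewrite /poisson_pmf lambda_gt0 expr0 fact0 invr1 !mul1r in P0.
have lo : (prob k (p n) (fun Y : faces n => X Y == 0%N) -
    prob k (p n) (@midsize_component k n)) @[n --> \oo] --> expR (- lambda).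
  by rewrite -[X in _ --> X]subr0; exact: cvgB P0 cvg_midsize.
apply: squeeze_cvgr lo P0; near=> n.
have kn : (k < n)%N by near: n; exists k.+1.
apply/andP; split; last first.
  by apply: le_prob => Y conn; apply/eqP; exact: connected_no_isolated.
rewrite lerBlDr; apply: le_trans (probU_le _ _ _ _); apply: le_prob => Y /eqP X0 /=.
case: (boolP (midsize_component k Y)) => mid; first by rewrite orbT.
by rewrite (no_midsize_connected k_gt0).
Unshelve. all: by end_near. Qed.

Lemma cvg_giant (eps : R) : 0 < eps ->
  prob k (p n) (@giant_and_isolated k n R eps) @[n --> \oo] --> (1 : R).
Proof.
(* The cap 1/2 ensures that at most e N isolated hypervertices leave a non-isolated one. Markov's
   inequality bounds the probability of more than e N of them by E X / (e N), which vanishes as E X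
   converges and N grows. *)
move=> eps0; pose e := Num.min eps 2^-1.
have e0 : 0 < e by rewrite lt_min eps0 invr_gt0 ltr0n.
have NV : ('C(n, k)%:R^-1 : R) @[n --> \oo] --> (0 : R).
  exact: (cvg_comp _ _ (cvg_bin_infty k_gt0) (@cvg_natV R)).
have err : (isolated_bin_moment k n (p n) 1 * (e^-1 * 'C(n, k)%:R^-1))
    @[n --> \oo] --> (0 : R).
  rewrite -[X in _ --> X](mulr0 (lambda ^+ 1 / 1`!%:R)).
  apply: cvgM; first exact: cvg_isolated_bin_moment.
  rewrite -[X in _ --> X](mulr0 e^-1); apply: cvgM => //; exact: cvg_cst.
have lo : (1 - prob k (p n) (@midsize_component k n) -
    isolated_bin_moment k n (p n) 1 * (e^-1 * 'C(n, k)%:R^-1)) @[n --> \oo] --> (1 : R).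
  rewrite -[X in _ --> X]subr0; apply: cvgB => //.
  rewrite -[X in _ --> X]subr0; apply: cvgB; [exact: cvg_cst | exact: cvg_midsize].
apply: (squeeze_cvgr _ lo (cvg_cst (1 : R))); near=> n.
have kn : (k < n)%N by near: n; exists k.+1.
rewrite prob_le1 andbT !lerBlDr.
have N0 : 0 < 'C(n, k)%:R :> R by rewrite ltr0n bin_gt0 ltnW.
have markov : prob k (p n) (fun Y : faces n => e * 'C(n, k)%:R < (X Y)%:R) <=
    isolated_bin_moment k n (p n) 1 * (e^-1 * 'C(n, k)%:R^-1).
  rewrite -invfM ler_pdivlMr ?mulr_gt0// /prob mulr_suml big_mkcond.
  apply: ler_sum => Y _; have w0 := complex_pmf_ge0 k (p n) Y.
  rewrite bin1; case: ifPn => XY; first by rewrite ler_wpM2l// ltW.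
  by rewrite mulr_ge0.
rewrite -[leLHS](probT k n (p n)).
apply: (@le_trans _ _ (prob k (p n) (predU (predU (@giant_and_isolated k n R eps)
  (fun Y : faces n => e * 'C(n, k)%:R < (X Y)%:R)) (@midsize_component k n)))).
  apply: le_prob => Y _ /=.
  case: (boolP (midsize_component k Y)) => mid; first by rewrite orbT.
  rewrite orbF; case: (ltP (e * 'C(n, k)%:R) (X Y)%:R) => XY; rewrite ?orbT// orbF.
  apply: no_midsize_giant => //.
    rewrite -(ltr_nat R); apply: le_lt_trans XY _.
    have : e <= 2^-1 by rewrite ge_min lexx orbT.
    by nra.
  by apply: le_trans XY _; rewrite ler_wpM2r// ge_min lexx.
apply: le_trans (probU_le _ _ _ _) _; apply: lerD => //.
apply: le_trans (probU_le _ _ _ _) _; exact: lerD.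
Unshelve. all: by end_near. Qed.

Lemma cvg_isolated_lt J :
  prob k (p n) (fun Y : faces n => (X Y < J)%N) @[n --> \oo] -->
  \sum_(j < J) poisson_pmf lambda j.
Proof.
under eq_fun do rewrite prob_ltn.
apply: (@cvg_sum_ord R J (fun j n => prob k (p n) (fun Y : faces n => X Y == j))
  (poisson_pmf lambda)) => j.
exact: cvg_isolated_eq.
Qed.

End critical_window.

(** * Transfer to measures and distribution functions *)

Lemma cvg_random_complex (R : realType) k (p : nat -> R)
    (A : forall n, pred (faces n)) (l : R) :
  prob k (p n) (A n) @[n --> \oo] --> l ->
  random_complex k n (p n) [set Y : faces n | A n Y] @[n --> \oo] --> l%:E.
Proof.
move=> Al; under eq_fun do rewrite random_complexE.
by apply: cvg_EFin; [exact: nearW | exact: Al].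
Qed.

(** J is the least natural number above x, hence 0 for negative x; it turns distribution functions
    at x into finite sums of point masses. *)
Lemma exists_natr_le (R : realType) (x : R) :
  exists J : nat, forall j : nat, (j%:R <= x) = (j < J)%N.
Proof.
have ex : exists J : nat, x < J%:R.
  exists (Num.bound `|x|); apply: le_lt_trans (ler_norm x) _.
  exact: archi_boundP.
case: (ex_minnP ex) => J xJ Jmin; exists J => j; apply/idP/idP => [jx|jJ].
  by rewrite -(ltr_nat R); exact: le_lt_trans jx xJ.
by rewrite leNgt; apply/negP => /Jmin; rewrite leqNgt jJ.
Qed.

Lemma cdf_nb_isolated (R : realType) k n (p x : R) J :
    (forall j : nat, (j%:R <= x) = (j < J)%N) ->
  cdf (nb_isolated k n : {RV (random_complex k n p) >-> R}) x =
  (prob k p (fun Y : faces n => #|[set a | isolated_hypervertex k Y a]%SET| < J)%N)%:E.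
Proof.
move=> xJ; rewrite -random_complexE /cdf /distribution /pushforward.
congr (random_complex _ _ _ _); apply/seteqP; split => Y /=;
  by rewrite in_itv/= /nb_isolated xJ.
Qed.

Lemma cdf_poisson (R : realType) (lambda x : R) J : 0 < lambda ->
    (forall j : nat, (j%:R <= x) = (j < J)%N) ->
  cdf (nat_val : {RV (poisson_prob lambda 0) >-> R}) x =
  (\sum_(j < J) poisson_pmf lambda j)%:E.
Proof.
move=> l0 xJ; transitivity (poisson_prob lambda 0 `I_J).
  congr (poisson_prob _ _ _).
  by apply/seteqP; split => j /=; rewrite in_itv/= /nat_val xJ.
rewrite /poisson_prob l0.
rewrite esum_fset//; last by move=> j _; rewrite lee_fin poisson_pmf_ge0.
by rewrite -fsbig_ord/= sumEFin.
Qed.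

Lemma HG_connectedS k n (Y V : faces n) : (V : {set _}) \subset (Y : {set _}) ->
  HG_connected k V -> HG_connected k Y.
Proof.
move=> VY /forall_inP conn; apply/forall_inP => a aH; apply/forall_inP => b bH.
have /forall_inP /(_ _ bH) := conn a aH.
by apply: connect_sub => u v /(HG_adjS VY); exact: connect1.
Qed.

(** * The sharp threshold, by monotonicity in p *)

Section thresholds.
Context (R : realType) (k : nat) (omega : nat -> R).
Hypotheses (k_gt0 : (0 < k)%N) (omega_infty : omega n @[n --> \oo] --> +oo).

Lemma cvg_connected_supercritical :
  prob k ((k%:R * ln n%:R + omega n) / n%:R) (@HG_connected k n)
    @[n --> \oo] --> (1 : R).
Proof.
(* This c gives exp(-c) = e / 2, so the critical limit is at least 1 - e / 2; eventually omega
   exceeds c. *)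
apply/cvgrPdist_lt => e e0; pose c := - ln (e / 2).
have e2 : 0 < e / 2 by rewrite divr_gt0.
have ec : expR (- c) = e / 2 by rewrite opprK lnK.
have lim : 1 - e / 2 <= expR (- (expR (- c) / k`!%:R)).
  apply: le_trans (expR_ge1Dx _); rewrite ec lerD2l lerN2.
  rewrite ler_pdivrMr ?ltr0n ?fact_gt0//.
  by apply: ler_peMr; [exact: ltW | rewrite ler1n fact_gt0].
near=> n.
have close : `|expR (- (expR (- c) / k`!%:R)) -
    prob k ((k%:R * ln n%:R + c) / n%:R) (@HG_connected k n)| < e / 2.
  by near: n; have /cvgrPdist_lt := @cvg_connected R k c k_gt0; exact.
have mono : prob k ((k%:R * ln n%:R + c) / n%:R) (@HG_connected k n) <=
    prob k ((k%:R * ln n%:R + omega n) / n%:R) (@HG_connected k n).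
  apply: prob_monotone; last by move=> Y V; exact: HG_connectedS.
  rewrite ler_wpM2r ?invr_ge0// lerD2l.
  by near: n; move/cvgryPge: omega_infty; exact.
have := prob_le1 k ((k%:R * ln n%:R + omega n) / n%:R) (@HG_connected k n).
move=> le1; rewrite ger0_norm ?subr_ge0//.
move: close; rewrite ltr_norml => /andP[_]; move: lim mono.
set x := expR _; set y := prob _ _ _; set z := prob _ _ _; lra.
Unshelve. all: by end_near. Qed.

Lemma cvg_connected_subcritical :
  prob k ((k%:R * ln n%:R - omega n) / n%:R) (@HG_connected k n)
    @[n --> \oo] --> (0 : R).
Proof.
(* This c makes the Poisson mean 2 / e, and exp(-2 / e) <= e / 2 since exp(x) >= x; eventually
   -omega is below c. *)
apply/cvgrPdist_lt => e e0; pose c := - ln (2 / e * k`!%:R).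
have k0 : 0 < k`!%:R :> R by rewrite ltr0n fact_gt0.
have e2 : 0 < 2 / e by rewrite divr_gt0.
have ec : expR (- c) / k`!%:R = 2 / e.
  by rewrite opprK lnK ?posrE ?(mulr_gt0 e2 k0)// mulfK// gt_eqF.
have lim : expR (- (expR (- c) / k`!%:R)) <= e / 2.
  rewrite ec expRN -[leRHS]invf_div lef_pV2 ?posrE ?expR_gt0//.
  by apply: le_trans (expR_ge1Dx _); rewrite lerDr.
near=> n.
have close : `|expR (- (expR (- c) / k`!%:R)) -
    prob k ((k%:R * ln n%:R + c) / n%:R) (@HG_connected k n)| < e / 2.
  near: n; have /cvgrPdist_lt := @cvg_connected R k c k_gt0; apply.
  by rewrite divr_gt0.
have mono : prob k ((k%:R * ln n%:R - omega n) / n%:R) (@HG_connected k n) <=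
    prob k ((k%:R * ln n%:R + c) / n%:R) (@HG_connected k n).
  apply: prob_monotone; last by move=> Y V; exact: HG_connectedS.
  rewrite ler_wpM2r ?invr_ge0// lerD2l lerNl.
  by near: n; move/cvgryPge: omega_infty; exact.
have ge0 := prob_ge0 k ((k%:R * ln n%:R - omega n) / n%:R) (@HG_connected k n).
rewrite sub0r normrN ger0_norm//.
move: close; rewrite ltr_norml => /andP[+ _]; move: lim mono.
set x := expR _; set y := prob _ _ _; set z := prob _ _ _; lra.
Unshelve. all: by end_near. Qed.

End thresholds.

(* The natural number argument of poisson_prob is unused in the library. *)
Theorem theorem1p8 (R : realType) (k : nat) (k_ge1 : (1 <= k)%N) :
  (forall c : R,
    let p (n : nat) : R := (k%:R * ln n%:R + c) / n%:R in
    let lambda : R := expR (- c) / k`!%:R in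
    [/\ forall eps : R, 0 < eps ->
          random_complex k n (p n) [set Y : faces n | giant_and_isolated k eps Y]
            @[n --> \oo] --> 1%E,
        cvg_in_distribution
          (fun n => nb_isolated k n : {RV (random_complex k n (p n)) >-> R})
          (nat_val : {RV (poisson_prob lambda 0) >-> R}) &
        random_complex k n (p n) [set Y : faces n | HG_connected k Y]
          @[n --> \oo] --> (expR (- lambda))%:E])
  /\
  (forall omega : nat -> R, omega n @[n --> \oo] --> +oo ->
    random_complex k n ((k%:R * ln n%:R + omega n) / n%:R)
        [set Y : faces n | HG_connected k Y] @[n --> \oo] --> 1%E
    /\
    random_complex k n ((k%:R * ln n%:R - omega n) / n%:R)
        [set Y : faces n | ~~ HG_connected k Y] @[n --> \oo] --> 1%E).
Proof.
split=> [c p lambda|omega omega_infty]; split.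
- move=> eps eps0.
  apply: (@cvg_random_complex R k p (fun n => @giant_and_isolated k n R eps)).
  exact: cvg_giant.
- move=> x _; have [J xJ] := exists_natr_le x.
  rewrite (cdf_poisson _ xJ); last exact: lambda_gt0.
  under eq_fun do rewrite (cdf_nb_isolated _ _ _ xJ).
  apply: cvg_EFin; first exact: nearW.
  exact: cvg_isolated_lt.
- apply: (@cvg_random_complex R k p (fun n => @HG_connected k n)).
  exact: cvg_connected.
- apply: (@cvg_random_complex R k _ (fun n => @HG_connected k n)).
  exact: cvg_connected_supercritical.
- apply: (@cvg_random_complex R k _ (fun n Y => ~~ @HG_connected k n Y)).
  have lim : (1 - prob k ((k%:R * ln n%:R - omega n) / n%:R) (@HG_connected k n))
      @[n --> \oo] --> (1 - 0 : R).
    by apply: cvgB; [exact: cvg_cst | exact: cvg_connected_subcritical].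
  rewrite subr0 in lim; apply: cvg_trans lim; apply: near_eq_cvg.
  by apply: nearW => n; rewrite -probC.
Qed.
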